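(* Let $a,b,b_1,b_2,a_1,a_2,c,c_1,c_2,d\in\mathbb{C}$ with $c,c_1,c_2,d\notin\{0,-1,-2,\dots\}$. Then, for all sufficiently small values of the variables: $$\mathcal{H}_{c}^{a}(t)\,(1-tx)^{-b_1}(1-ty)^{-b_2}=F_1(a;b_1,b_2;c;tx,ty);$$ $$\mathcal{H}_{c_1}^{b_1}(x)\,\mathcal{H}_{c_2}^{b_2}(y)\,(1-x-y)^{-a}=F_2(a;b_1,b_2;c_1,c_2;x,y);$$ $$\mathcal{H}_{1}^{a_1}(x)\,\mathcal{H}_{\frac12}^{b_1}(x)\,\mathcal{H}_{1}^{a_2}(y)\,\mathcal{H}_{\frac12}^{b_2}(y)\,\mathcal{H}_{c}^{\frac32}(t)\,\frac{\arctan\sqrt{t^2xy-tx-ty}}{\sqrt{t^2xy-tx-ty}}=F_3(a_1,b_1,a_2,b_2;c;tx,ty);$$ $$\mathcal{H}_{c}^{\frac12}(x)\,\mathcal{H}_{d}^{\frac12}(y)\,\mathcal{H}_{\frac12}^{b}(t)\,\mathcal{H}_{1}^{a}(t)\,\frac{1-t(x+y)}{1-2t(x+y)+t^2(x-y)^2}=F_4(a,b;c,d;tx,ty).$$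
   Context: $(q)_n=q(q+1)\cdots(q+n-1)$, $(q)_0=1$. For a function analytic near the origin in several variables, $\mathcal{H}_c^a(t)$ (with $c\notin\{0,-1,-2,\dots\}$) denotes hypergeometrization in the variable $t$: it multiplies the coefficient of each monomial containing $t^n$ in the Taylor series at the origin by $\frac{(a)_n}{(c)_n}$, the other variables being treated as parameters; similarly $\mathcal{H}_c^a(x)$, $\mathcal{H}_c^a(y)$. Juxtaposition is composition of operators. Powers are the branches equal to $1$ at the origin; $\frac{\arctan\sqrt w}{\sqrt w}$ denotes the analytic function $\sum_{n\ge0}\frac{(-1)^nw^n}{2n+1}$ near $w=0$. Appell's functions (series near the origin): $F_1(a;b_1,b_2;c;X,Y)=\sum_{j,k\ge0}\frac{(a)_{j+k}}{(c)_{j+k}}\frac{(b_1)_j(b_2)_k}{j!k!}X^jY^k$, $F_2(a;b_1,b_2;c_1,c_2;X,Y)=\sum_{j,k\ge0}\frac{(a)_{j+k}}{j!k!}\frac{(b_1)_j(b_2)_k}{(c_1)_j(c_2)_k}X^jY^k$, $F_3(a_1,b_1,a_2,b_2;c;X,Y)=\sum_{j,k\ge0}\frac{(a_1)_j(b_1)_j(a_2)_k(b_2)_k}{(c)_{j+k}j!k!}X^jY^k$, $F_4(a,b;c,d;X,Y)=\sum_{j,k\ge0}\frac{(a)_{j+k}(b)_{j+k}}{(c)_j(d)_kj!k!}X^jY^k$. *)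

(* Defs.v *)
From HB Require Import structures.
From mathcomp Require Import all_boot all_order all_algebra.
From mathcomp Require Import complex.
From mathcomp Require Import all_classical all_reals all_analysis.

Set Implicit Arguments.
Unset Strict Implicit.
Unset Printing Implicit Defensive.

Import Order.TTheory GRing.Theory Num.Theory.
Import numFieldNormedType.Exports.

Local Open Scope classical_set_scope.
Local Open Scope ring_scope.
Local Open Scope complex_scope.

Section NumField.
Variable K : numFieldType.
Implicit Types (a b c d q z w X Y : K) (f : K -> K) (F : K -> K -> K -> K).

Definition pochhammer q (n : nat) : K := \prod_(i < n) (q + i%:R).

(* derive1n n f is the n-th derivative over the field K itself, i.e. the complex
   derivative when K = R[i]. *)
Definition taylor_coef f (n : nat) : K := derive1n n f 0 / n`!%:R.

(* The operator H_c^a of one variable, for f analytic near 0. *)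
Definition hypergeometrization a c f z : K :=
  limn (series (fun n =>
    pochhammer a n / pochhammer c n * taylor_coef f n * z ^+ n)).

Definition hyp_t a c F : K -> K -> K -> K :=
  fun t x y => hypergeometrization a c (fun s => F s x y) t.
Definition hyp_x a c F : K -> K -> K -> K :=
  fun t x y => hypergeometrization a c (fun s => F t s y) x.
Definition hyp_y a c F : K -> K -> K -> K :=
  fun t x y => hypergeometrization a c (fun s => F t x s) y.

(* Sum of a double series, as the limit of its square partial sums; the Appell
   series below are absolutely convergent near the origin, so the order of
   summation is irrelevant. *)
Definition double_series (u : nat -> nat -> K) : K :=
  limn (fun n => \sum_(0 <= j < n) \sum_(0 <= k < n) u j k).

Definition appellF1 a b1 b2 c X Y : K := double_series (fun j k =>
  pochhammer a (j + k) / pochhammer c (j + k)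
  * (pochhammer b1 j * pochhammer b2 k / (j`!%:R * k`!%:R))
  * X ^+ j * Y ^+ k).

Definition appellF2 a b1 b2 c1 c2 X Y : K := double_series (fun j k =>
  pochhammer a (j + k) / (j`!%:R * k`!%:R)
  * (pochhammer b1 j * pochhammer b2 k / (pochhammer c1 j * pochhammer c2 k))
  * X ^+ j * Y ^+ k).

Definition appellF3 a1 b1 a2 b2 c X Y : K := double_series (fun j k =>
  pochhammer a1 j * pochhammer b1 j * pochhammer a2 k * pochhammer b2 k
  / (pochhammer c (j + k) * j`!%:R * k`!%:R)
  * X ^+ j * Y ^+ k).

Definition appellF4 a b c d X Y : K := double_series (fun j k =>
  pochhammer a (j + k) * pochhammer b (j + k)
  / (pochhammer c j * pochhammer d k * j`!%:R * k`!%:R)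
  * X ^+ j * Y ^+ k).

(* The analytic function arctan(sqrt w) / sqrt w near w = 0. *)
Definition arctan_sqrt_div_sqrt w : K :=
  limn (series (fun n => (-1) ^+ n * w ^+ n / (2 * n + 1)%N%:R)).

End NumField.

Section Complex.
Variable R : realType.
Implicit Types z w b : R[i].

Definition cexp z : R[i] :=
  (expR (complex.Re z))%:C * (cos (complex.Im z) +i* sin (complex.Im z)).

(* Principal argument, in ]-pi, pi] for z != 0. *)
Definition carg z : R :=
  let theta := acos (complex.Re z / ComplexField.Normc.normc z) in
  if 0 <= complex.Im z then theta else - theta.

Definition clog z : R[i] := ln (ComplexField.Normc.normc z) +i* carg z.

(* Principal power, for z != 0; it is analytic near z = 1, with value 1 there,
   so that F ^ b is the branch equal to 1 at the origin when F = 1 there. *)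
Definition cpow z b : R[i] := cexp (b * clog z).

End Complex.

(* Main.v *)
Require Import Defs.
From HB Require Import structures.
From mathcomp Require Import all_boot all_order all_algebra.
From mathcomp Require Import complex.
From mathcomp Require Import all_classical all_reals all_analysis.
From mathcomp Require Import ring lra zify.

Set Implicit Arguments.
Unset Strict Implicit.
Unset Printing Implicit Defensive.

Import Order.TTheory GRing.Theory Num.Theory.
Import numFieldNormedType.Exports.

Local Open Scope ring_scope.
Local Open Scope complex_scope.

(** Near the origin each of the four functions to which the operators are
    applied is a double power series in the products tx and ty,

      F(t,x,y) = sum over j, k of v_jk (tx)^j (ty)^k,    |v_jk| <= C M^(j+k)

    (has_expansion). On such functions the operators are diagonal: the one in x
    multiplies v_jk by (a)_j/(c)_j, the one in y by (a)_k/(c)_k and the one in t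
    by (a)_(j+k)/(c)_(j+k) (has_expansion_hyp_x, has_expansion_hyp_y,
    has_expansion_hyp_t). The reason is that for fixed t and y the series,
    summed by rows, is a power series in x, while for fixed x and y, summed by
    antidiagonals, it is a power series in t; and the Taylor coefficients of a
    power series are its coefficients (taylor_coef_power_series). The functions
    of the second identity are the case t = 1. Ratios of Pochhammer symbols grow
    at most geometrically (ratio_bounded_exists), so the bound on v_jk survives
    each operator, with a larger M. It remains to find v for the four functions
    and to multiply out.

    - (1-X)^(-b1) (1-Y)^(-b2) and (1-X-Y)^(-a) come from the binomial series
      (binomial_seriesE), which equals the principal power because its product
      with (1-w)^b has derivative zero along the segment from 0 to the point.
    - The arctangent function at XY-X-Y has v_jk = (1/2)_j (1/2)_k / (3/2)_(j+k)
      (arctan_series_expansion). It is a power series in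
      X+Y-XY = X + Y(1-X), which is expanded by the binomial theorem; the
      coefficient of Y^k on both sides, a power series in X, satisfies the same
      differential recurrence in k.
    - (1-X-Y)/(1-2(X+Y)+(X-Y)^2) has v_jk = C(2j+2k, 2j)
      (even_binomial_expansion): with X = p^2 and Y = q^2 it is the half sum of
      1/(1-(p+q)^2) and 1/(1-(p-q)^2).

    All rearrangements and termwise derivations are instances of one dominated
    convergence statement, cvg_csum_dominated. Since only small arguments
    matter, one dominating ratio, 1/2 (1/4 for double series), is enough
    throughout, and completeness of the field enters only as convergence of the
    series so dominated (sums_half_bounded, proved in complex_sums_half_bounded). *)

(** * Series dominated by a geometric series *)

Section GeometricSummation.
Local Open Scope classical_set_scope.
Variable K : numFieldType.
Implicit Types (u g : nat -> K) (C : K) (n N : nat).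

Definition csum u : K := limn (series u).

Definition half_bounded C u := forall n, `|u n| <= C * 2^-1 ^+ n.

(** The form in which completeness of the field is used. It also forces 2^-n to
    tend to 0. *)
Definition sums_half_bounded :=
  forall C u, half_bounded C u -> cvgn (series u).

Lemma half_bounded_ge0 C u : half_bounded C u -> 0 <= C.
Proof. by move=> /(_ 0); rewrite expr0 mulr1; apply: le_trans. Qed.

Lemma csum_eq u l : series u @ \oo --> l -> csum u = l.
Proof. by move=> ul; apply: cvg_lim. Qed.

Lemma eq_csum u g : u =1 g -> csum u = csum g.
Proof. by move=> /funext ->. Qed.

Hypothesis Ksum : sums_half_bounded.

Lemma cvg_csum C u : half_bounded C u -> series u @ \oo --> csum u.
Proof. exact: Ksum. Qed.

Lemma cvg_half0 : (fun n => 2^-1 ^+ n : K) @ \oo --> (0 : K).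
Proof.
apply: cvg_series_cvg_0; apply: (@Ksum 1) => n.
by rewrite mul1r ger0_norm // exprn_ge0 // invr_ge0 ler0n.
Qed.

Lemma sum_half_le N n : \sum_(N <= i < n) 2^-1 ^+ i <= 2 * 2^-1 ^+ N :> K.
Proof.
have half_ge0 i : 0 <= 2 * 2^-1 ^+ i :> K.
  by rewrite mulr_ge0 // exprn_ge0 // invr_ge0 ler0n.
have [nN|Nn] := leqP n N; first by rewrite big_geq.
have halfS i : 2^-1 ^+ i = - (2 * 2^-1 ^+ i.+1) - - (2 * 2^-1 ^+ i) :> K.
  rewrite exprS mulrA divff ?pnatr_eq0 // mul1r opprK.
  by rewrite -{2}[2]/(1 + 1) mulrDl mul1r addKr.
rewrite (eq_bigr _ (fun i _ => halfS i)) telescope_sumr ?(ltnW Nn) // opprK.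
by rewrite gerDr oppr_le0.
Qed.

(** The bound does not depend on u, which is what allows the interchanges of
    limits below. *)
Lemma csum_tail C u N : half_bounded C u ->
  `|csum u - \sum_(0 <= i < N) u i| <= C * 2 * 2^-1 ^+ N.
Proof.
move=> uC; have C0 := half_bounded_ge0 uC; apply/ler_addgt0Pr => e e0.
have /cvgrPdist_le/(_ _ e0) [M _ Me] := cvg_csum uC.
have MN : (M <= maxn M N)%N by rewrite leq_maxl.
have {Me} /= Me := Me _ MN.
rewrite -(subrKA (series u (maxn M N))) addrC.
apply: le_trans (ler_normD _ _) _; apply: lerD => //.
rewrite -[X in _ - X]/(series u N) sub_series_geq ?leq_maxr //.
apply: le_trans (ler_norm_sum _ _ _) _.
apply: le_trans (ler_sum _ (fun i _ => uC i)) _.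
by rewrite -mulr_sumr -mulrA ler_wpM2l // sum_half_le.
Qed.

Lemma csum_norm_le C u : half_bounded C u -> `|csum u| <= C * 2.
Proof.
by move=> uC; have := csum_tail 0 uC; rewrite big_geq // subr0 expr0 mulr1.
Qed.

(** Dominated convergence (Tannery's theorem): beyond a rank N the tails are
    uniformly small, and up to N the sum is finite. *)
Lemma cvg_csum_dominated (T : Type) (F : set_system T) {FF : Filter F}
    (f : T -> nat -> K) g C :
  (\forall t \near F, half_bounded C (f t)) -> half_bounded C g ->
  (forall n, f ^~ n @ F --> g n) -> (fun t => csum (f t)) @ F --> csum g.
Proof.
move=> fC gC fg; have C0 := half_bounded_ge0 gC.
apply/cvgrPdist_le => e e0; have e30 : 0 < e / 3 by rewrite divr_gt0.
have [N _ /(_ N (leqnn N)) /= Ne] : \forall N \near \oo, C * 2 * 2^-1 ^+ N <= e / 3.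
  have : (fun N => C * 2 * 2^-1 ^+ N) @ \oo --> C * 2 * (0 : K).
    apply: cvgM; [exact: cvg_cst|exact: cvg_half0].
  rewrite mulr0 => /cvgrPdist_le/(_ _ e30); apply: filterS => n.
  rewrite sub0r normrN; apply: le_trans; rewrite ger0_norm //.
  by rewrite !mulr_ge0 // exprn_ge0 // invr_ge0 ler0n.
have : (fun t => \sum_(0 <= i < N) f t i) @ F --> \sum_(0 <= i < N) g i.
  by apply: cvg_big => [|i _]; [exact: add_continuous|exact: fg].
move=> /cvgrPdist_le/(_ _ e30); apply: filterS2 fC => t ftC fgt.
have -> : csum g - csum (f t) =
   (csum g - \sum_(0 <= i < N) g i)
   + (\sum_(0 <= i < N) g i - \sum_(0 <= i < N) f t i)
   - (csum (f t) - \sum_(0 <= i < N) f t i) by ring.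
have -> : e = e / 3 + e / 3 + e / 3 by field.
apply: le_trans (ler_normB _ _) _; apply: lerD; last first.
  exact: le_trans (csum_tail N ftC) Ne.
apply: le_trans (ler_normD _ _) _; apply: lerD => //.
exact: le_trans (csum_tail N gC) Ne.
Qed.

Lemma csumZ C u (a : K) : half_bounded C u ->
  csum (fun n => a * u n) = a * csum u.
Proof.
move=> /cvg_csum uC; apply: csum_eq.
rewrite (_ : series _ = fun n => a * series u n); last first.
  by apply/funext => n; rewrite /series /= mulr_sumr.
by apply: cvgM => //; exact: cvg_cst.
Qed.

End GeometricSummation.

Section MoreSummation.
Local Open Scope classical_set_scope.
Variable K : numFieldType.
Implicit Types (u g : nat -> K) (C M s : K) (n N : nat).

Lemma csum_finite u N : (forall n, (N <= n)%N -> u n = 0) ->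
  csum u = \sum_(0 <= i < N) u i.
Proof.
move=> uN; apply: csum_eq; apply/cvgrPdist_le => e e0.
exists N => // n /= Nn; rewrite /series /= (big_cat_nat _ Nn) //=.
rewrite [X in _ - (_ + X)]big_nat_cond [X in _ - (_ + X)]big1.
  by rewrite addr0 subrr normr0 ltW.
by move=> i /andP[/andP[/uN]].
Qed.

Lemma cvg_if_lt u (l : K) N : u @ \oo --> l ->
  (fun n => if (N < n)%N then u n else 0) @ \oo --> l.
Proof.
apply: cvg_trans; apply: near_eq_cvg; exists N.+1 => // n /=.
by rewrite -ltnS => ->.
Qed.

Hypothesis Ksum : sums_half_bounded K.

Lemma csumB C C' u g : half_bounded C u -> half_bounded C' g ->
  csum (fun n => u n - g n) = csum u - csum g.
Proof.
move=> /(cvg_csum Ksum) uC /(cvg_csum Ksum) gC'; apply: csum_eq.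
rewrite (_ : series _ = fun n => series u n - series g n); last first.
  by apply/funext => n; rewrite /series /= sumrB.
exact: cvgB.
Qed.

Lemma csum_shift C u : half_bounded C u -> u 0 = 0 ->
  csum u = csum (fun n => u n.+1).
Proof.
move=> /(cvg_csum Ksum) uC u0; apply/esym/csum_eq.
rewrite (_ : series _ = fun n => series u n.+1); last first.
  by apply/funext => n; rewrite /series /= big_nat_recl //= u0 add0r.
by have := uC; rewrite -(cvg_shiftS (series u)).
Qed.

(** * Double series *)

(** The ratio 1/4 leaves room for the n+1 terms of an antidiagonal:
    (n+1) 4^-n <= 2^-n. *)
Definition quarter_bounded C (u : nat -> nat -> K) :=
  forall j k, `|u j k| <= C * 4^-1 ^+ (j + k).

Lemma quarterE n : 4^-1 ^+ n = 2^-1 ^+ n * 2^-1 ^+ n :> K.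
Proof. by rewrite -exprMn -invfM -natrM. Qed.

Lemma half_ge0 n : 0 <= 2^-1 ^+ n :> K.
Proof. by rewrite exprn_ge0 // invr_ge0 ler0n. Qed.

Lemma half_le1 n : 2^-1 ^+ n <= 1 :> K.
Proof.
by rewrite exprn_ile1 ?invr_ge0 ?ler0n // invf_le1 ?ltr0n // ler1n.
Qed.

Lemma quarter_le_half n : 4^-1 ^+ n <= 2^-1 ^+ n :> K.
Proof. by rewrite quarterE -[leRHS]mulr1 ler_wpM2l ?half_ge0 ?half_le1. Qed.

Lemma natr_quarter_le_half n : n.+1%:R * 4^-1 ^+ n <= 2^-1 ^+ n :> K.
Proof.
rewrite quarterE mulrA -[leRHS]mul1r ler_wpM2r ?half_ge0 //.
rewrite exprVn -natrX ler_pdivrMr ?ltr0n ?expn_gt0 // mul1r ler_nat.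
exact: ltn_expl.
Qed.

Lemma quarter_bounded_ge0 C (u : nat -> nat -> K) : quarter_bounded C u -> 0 <= C.
Proof. by move=> /(_ 0 0)%N; rewrite expr0 mulr1; apply: le_trans. Qed.

Lemma half_bounded_row C (u : nat -> nat -> K) j : quarter_bounded C u ->
  half_bounded (C * 2^-1 ^+ j) (u j).
Proof.
move=> uC k; have C0 := quarter_bounded_ge0 uC.
apply: le_trans (uC _ _) _.
by rewrite -mulrA -exprD ler_wpM2l // quarter_le_half.
Qed.

Lemma row_partial_sum_le C (u : nat -> nat -> K) j n : quarter_bounded C u ->
  `|\sum_(0 <= k < n) u j k| <= C * 2 * 2^-1 ^+ j.
Proof.
move=> uC; have C0 := quarter_bounded_ge0 uC.
apply: le_trans (ler_norm_sum _ _ _) _.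
apply: le_trans (ler_sum _ (fun k _ => half_bounded_row j uC k)) _.
rewrite -mulr_sumr [leRHS]mulrAC ler_wpM2l ?mulr_ge0 ?half_ge0 //.
by have := sum_half_le K 0 n; rewrite expr0 mulr1.
Qed.

Lemma half_bounded_rows C (u : nat -> nat -> K) : quarter_bounded C u ->
  half_bounded (C * 2) (fun j => csum (u j)).
Proof.
move=> uC j; rewrite mulrAC.
exact: csum_norm_le (half_bounded_row _ uC).
Qed.

Lemma double_series_eq (u : nat -> nat -> K) (l : K) :
  (fun n => \sum_(0 <= j < n) \sum_(0 <= k < n) u j k) @ \oo --> l ->
  double_series u = l.
Proof. by move=> ul; apply: cvg_lim. Qed.

(** Square partial sums are sums over j of truncated rows, and these converge
    to the full rows dominatedly. *)
Lemma double_series_rows C (u : nat -> nat -> K) : quarter_bounded C u ->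
  double_series u = csum (fun j => csum (u j)).
Proof.
move=> uC; have C0 := quarter_bounded_ge0 uC; apply: double_series_eq.
pose f n j := if (j < n)%N then \sum_(0 <= k < n) u j k else 0.
rewrite (_ : (fun n => _) = fun n => csum (f n)); last first.
  apply/funext => n; rewrite (@csum_finite _ n) => [|j nj]; last first.
    by rewrite /f ltnNge nj.
  by apply: eq_big_nat => j /andP[_ jn]; rewrite /f jn.
apply: (cvg_csum_dominated Ksum (C := C * 2)).
- apply: nearW => n j; rewrite /f; case: ifP => _.
    exact: row_partial_sum_le.
  by rewrite normr0 !mulr_ge0 ?half_ge0.
- exact: half_bounded_rows.
- move=> j; apply: cvg_if_lt; exact: cvg_csum (half_bounded_row _ uC).
Qed.

Lemma antidiagonal_sum_le C (u : nat -> nat -> K) m : quarter_bounded C u ->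
  `|\sum_(0 <= j < m.+1) u j (m - j)%N| <= C * 2^-1 ^+ m.
Proof.
move=> uC; have C0 := quarter_bounded_ge0 uC.
apply: le_trans (ler_norm_sum _ _ _) _.
apply: (@le_trans _ _ (\sum_(0 <= j < m.+1) C * 4^-1 ^+ m)).
  apply: ler_sum_nat => j /andP[_]; rewrite ltnS => jm.
  by apply: le_trans (uC _ _) _; rewrite subnKC.
rewrite sumr_const_nat subn0 -[_ *+ m.+1]mulr_natl mulrCA ler_wpM2l //.
exact: natr_quarter_le_half.
Qed.

(** The square of side n is the union of its truncated antidiagonals; each
    antidiagonal is complete as soon as n exceeds its index. *)
Lemma double_series_antidiagonals C (u : nat -> nat -> K) : quarter_bounded C u ->
  double_series u = csum (fun m => \sum_(0 <= j < m.+1) u j (m - j)%N).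
Proof.
move=> uC; have C0 := quarter_bounded_ge0 uC; apply: double_series_eq.
pose trunc n j k := if (j < n)%N && (k < n)%N then u j k else 0.
have truncC n : quarter_bounded C (trunc n).
  move=> j k; rewrite /trunc; case: ifP => // _.
  by rewrite normr0 mulr_ge0 // exprn_ge0 // invr_ge0 ler0n.
pose f n m := \sum_(0 <= j < m.+1) trunc n j (m - j)%N.
have fE n m : f n m =
    \sum_(0 <= j < n) \sum_(0 <= k < n | (k + j == m)%N) u j k.
  rewrite /f; transitivity (\sum_(0 <= j < n + m.+1)
     if (j < m.+1)%N then trunc n j (m - j)%N else 0).
    rewrite [RHS](@big_cat_nat _ _ _ m.+1) ?leq_addl //=.
    rewrite [X in _ + X]big_nat_cond [X in _ + X]big1 ?addr0; last first.
      by move=> j /andP[/andP[]]; rewrite leqNgt => /negbTE ->.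
    by apply: eq_big_nat => j /andP[_ ->].
  rewrite [LHS](@big_cat_nat _ _ _ n) ?leq_addr //=.
  rewrite [X in _ + X]big_nat_cond [X in _ + X]big1 ?addr0; last first.
    by move=> j /andP[/andP[]]; rewrite /trunc leqNgt => /negbTE ->; rewrite if_same.
  apply: eq_big_nat => j /andP[_ jn]; rewrite /trunc jn /= ltnS.
  case: (leqP j m) => jm.
    rewrite [RHS](eq_bigl (fun k => k == m - j)%N) => [|k]; last by lia.
    by rewrite big_nat1_eq leq0n.
  by rewrite big1 // => k /eqP km; move: jm; rewrite -km ltnNge leq_addl.
rewrite (_ : (fun n => _) = fun n => csum (f n)); last first.
  apply/funext => n; rewrite (@csum_finite _ (n + n)) => [|m nm]; last first.
    rewrite /f big_nat_cond big1 // => j /andP[/andP[_ jm] _].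
    rewrite /trunc; case: ifP => // /andP[jn mjn]; exfalso.
    move: nm; rewrite leqNgt => /negP; apply.
    rewrite -(subnKC (ltnSE jm)); lia.
  rewrite (eq_bigr _ (fun m _ => fE n m)) [RHS]exchange_big /=.
  apply: eq_big_nat => j /andP[_ jn].
  rewrite [RHS](exchange_big_dep xpredT) //=; apply: eq_big_nat => k /andP[_ kn].
  under eq_bigl => m do rewrite eq_sym.
  by rewrite big_nat1_eq ifT //; lia.
apply: (cvg_csum_dominated Ksum (C := C)).
- by apply: nearW => n m; exact: antidiagonal_sum_le.
- by move=> m; exact: antidiagonal_sum_le.
- move=> m; apply: cvg_near_cst; exists m.+1 => // n /= mn.
  apply: eq_big_nat => j /andP[_ jm]; rewrite /trunc ifT //; lia.
Qed.

Lemma double_seriesC (u : nat -> nat -> K) :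
  double_series u = double_series (fun j k => u k j).
Proof.
rewrite /double_series; set F := (X in limn X = _); set G := (X in _ = limn X).
by suff -> : F = G by []; apply/funext => n; rewrite /F exchange_big.
Qed.

Lemma double_seriesM C u g : half_bounded C u -> half_bounded C g ->
  double_series (fun j k => u j * g k) = csum u * csum g.
Proof.
move=> /(cvg_csum Ksum) uC /(cvg_csum Ksum) gC; apply: double_series_eq.
rewrite (_ : (fun n => _) = fun n => series u n * series g n); last first.
  apply/funext => n; rewrite /series /= mulr_suml.
  by apply: eq_bigr => j _; rewrite mulr_sumr.
exact: cvgM.
Qed.

Lemma eq_double_series (u v : nat -> nat -> K) : (forall j k, u j k = v j k) ->
  double_series u = double_series v.
Proof. by move=> uv; suff -> : u = v by []; apply/funext => j; apply/funext. Qed.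

Lemma half_bounded_geometric (w : K) : `|w| <= 2^-1 ->
  half_bounded 1 (fun n => w ^+ n).
Proof. by move=> w2 n; rewrite mul1r normrX lerXn2r // nnegrE // invr_ge0. Qed.

Lemma subr1_neq0_half (w : K) : `|w| <= 2^-1 -> 1 - w != 0.
Proof.
move=> w2; rewrite subr_eq0; apply: contraTneq w2 => <-.
by rewrite normr1 lt_geF // invf_lt1 ?ltr1n ?ltr0n.
Qed.

Lemma csum_geometric (w : K) : `|w| <= 2^-1 -> csum (fun n => w ^+ n) = (1 - w)^-1.
Proof.
move=> w2.
have wC := half_bounded_geometric w2; have w1 := subr1_neq0_half w2.
apply: (mulfI w1); rewrite divff // -(csumZ Ksum _ wC).
apply: csum_eq; rewrite (_ : series _ = fun n => 1 - w ^+ n); last first.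
  apply/funext => n; rewrite /series /= -mulr_sumr big_mkord -opprB.
  by rewrite mulNr -subrX1 opprB.
rewrite -[X in _ --> X]subr0; apply: cvgB; first exact: cvg_cst.
exact: cvg_series_cvg_0 (Ksum wC).
Qed.

End MoreSummation.

(** * Power series and their Taylor coefficients *)

Section PowerSeries.
Local Open Scope classical_set_scope.
Variable K : numFieldType.
Hypothesis Ksum : sums_half_bounded K.
Implicit Types (u : nat -> K) (f : K -> K) (C M s a b c h : K) (n : nat).

Definition exp_bounded C M u := 0 <= M /\ forall n, `|u n| <= C * M ^+ n.

Lemma exp_bounded_ge0 C M u : exp_bounded C M u -> 0 <= C.
Proof. by move=> [_ /(_ 0)]; rewrite expr0 mulr1; apply: le_trans. Qed.

Lemma scaled_power_le_half M s n : 0 <= M -> 2 * M * `|s| <= 1 ->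
  M ^+ n * `|s| ^+ n <= 2^-1 ^+ n.
Proof.
move=> M0 Ms; rewrite -exprMn lerXn2r ?nnegrE ?mulr_ge0 ?invr_ge0 //.
by rewrite -[leRHS]mul1r ler_pdivlMr ?ltr0n // mulrC mulrA.
Qed.

Lemma scaled_power_le_quarter M s n : 0 <= M -> 4 * M * `|s| <= 1 ->
  M ^+ n * `|s| ^+ n <= 4^-1 ^+ n.
Proof.
move=> M0 Ms; rewrite -exprMn lerXn2r ?nnegrE ?mulr_ge0 ?invr_ge0 //.
by rewrite -[leRHS]mul1r ler_pdivlMr ?ltr0n // mulrC mulrA.
Qed.

Lemma half_bounded_power C M u s : exp_bounded C M u -> 2 * M * `|s| <= 1 ->
  half_bounded C (fun n => u n * s ^+ n).
Proof.
move=> uM Ms n; have C0 := exp_bounded_ge0 uM; case: uM => M0 uM.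
rewrite normrM normrX; apply: (@le_trans _ _ (C * M ^+ n * `|s| ^+ n)).
  by rewrite ler_wpM2r // exprn_ge0.
by rewrite -mulrA ler_wpM2l // scaled_power_le_half.
Qed.

(** The sums over i are the quotients (a^n - b^n) / (a - b), which makes this
    the domination of difference quotients, uniform in the increment. *)
Lemma half_bounded_difference_quotient C M u a b : exp_bounded C M u ->
  4 * M * `|a| <= 1 -> 4 * M * `|b| <= 1 ->
  half_bounded (C * M * 2) (fun n => u n * \sum_(i < n) a ^+ (n.-1 - i) * b ^+ i).
Proof.
move=> uM Ma Mb n; have C0 := exp_bounded_ge0 uM; case: uM => M0 uM.
case: n => [|n]; first by rewrite big_ord0 mulr0 normr0 !mulr_ge0 ?half_ge0.
have scale2 j k : M ^+ (j + k) * (`|a| ^+ j * `|b| ^+ k) <= 4^-1 ^+ (j + k).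
  by rewrite !exprD mulrACA ler_pM ?mulr_ge0 ?exprn_ge0 ?scaled_power_le_quarter.
rewrite normrM /=.
apply: (@le_trans _ _ (C * M ^+ n.+1 * \sum_(i < n.+1) `|a| ^+ (n - i) * `|b| ^+ i)).
  apply: ler_pM => //; apply: le_trans (ler_norm_sum _ _ _) _.
  by apply: ler_sum => i _; rewrite normrM !normrX.
rewrite exprS mulrA -mulrA mulr_sumr.
apply: (@le_trans _ _ (C * M * \sum_(i < n.+1) 4^-1 ^+ n)).
  rewrite ler_wpM2l ?mulr_ge0 //; apply: ler_sum => i _.
  have := scale2 (n - i)%N i; rewrite subnK //; by rewrite -ltnS.
have -> : C * M * 2 * 2^-1 ^+ n.+1 = C * M * 2^-1 ^+ n.
  by rewrite exprS mulrA -(mulrA _ 2) divff ?pnatr_eq0 ?mulr1.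
rewrite ler_wpM2l ?mulr_ge0 // sumr_const card_ord -[_ *+ n.+1]mulr_natl.
exact: natr_quarter_le_half.
Qed.

Lemma scaled4_le_half M s : 8 * M * `|s| <= 1 -> 4 * M * `|s| <= 2^-1.
Proof.
move=> Ms; rewrite -[leRHS]mul1r ler_pdivlMr ?ltr0n //.
by have -> : 4 * M * `|s| * 2 = 8 * M * `|s| by ring.
Qed.

Lemma near_power_series_domain M s : 0 <= M -> 8 * M * `|s| < 1 ->
  \forall h \near (0 : K)^', 4 * M * `|h + s| < 1.
Proof.
move=> M0 Ms; have e0 : 0 < (8 * M + 1)^-1.
  by rewrite invr_gt0 ltr_wpDl ?mulr_ge0 ?ltr01.
have := @dnbhs0_le K K _ e0; apply: filterS => h hle.
have M8h : 8 * M * `|h| <= 1.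
  apply: (@le_trans _ _ (8 * M * (8 * M + 1)^-1)).
    by rewrite ler_wpM2l // mulr_ge0.
  by rewrite ler_pdivrMr ?mul1r ?lerDl ?ler01 // ltr_wpDl ?mulr_ge0 ?ltr01.
apply: (@le_lt_trans _ _ (4 * M * `|h| + 4 * M * `|s|)).
  by rewrite -mulrDr ler_wpM2l ?mulr_ge0 // ler_normD.
rewrite [ltRHS](_ : 1 = 2^-1 + 2^-1); last by field.
apply: ler_ltD; first exact: scaled4_le_half.
rewrite -[ltRHS]mul1r ltr_pdivlMr ?ltr0n //.
by have -> : 4 * M * `|s| * 2 = 8 * M * `|s| by ring.
Qed.

(** Dominated convergence of the difference quotients, in the form given by
    half_bounded_difference_quotient. *)
Lemma cvg_power_series_difference_quotient C M u s :
  exp_bounded C M u -> 8 * M * `|s| < 1 ->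
  h^-1 * (csum (fun n => u n * (h + s) ^+ n) - csum (fun n => u n * s ^+ n))
    @[h --> 0^'] --> csum (fun n => n.+1%:R * u n.+1 * s ^+ n).
Proof.
move=> uM Ms; have C0 := exp_bounded_ge0 uM; have M0 := uM.1.
have M8s : 8 * M * `|s| <= 1 by exact: ltW.
have M4s : 4 * M * `|s| <= 1.
  by rewrite (le_trans (scaled4_le_half M8s)) ?invf_le1 ?ltr0n ?ler1n.
have M24 (x : K) : 4 * M * `|x| <= 1 -> 2 * M * `|x| <= 1.
  apply: le_trans; rewrite -!mulrA ler_wpM2r ?mulr_ge0 //.
  by rewrite ler_nat.
pose q h n := u n * \sum_(i < n) (h + s) ^+ (n.-1 - i) * s ^+ i.
have near_dom := near_power_series_domain M0 Ms.
have -> : csum (fun n => n.+1%:R * u n.+1 * s ^+ n) = csum (q 0).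
  rewrite [RHS](csum_shift Ksum (C := C * M * 2)); last first.
  - by rewrite /q big_ord0 mulr0.
  - by apply: half_bounded_difference_quotient; rewrite ?add0r.
  apply: eq_csum => n; rewrite /q add0r /= mulrAC [LHS]mulrC; congr (_ * _).
  rewrite (eq_bigr (fun=> s ^+ n)) => [|i _]; last first.
    by rewrite -exprD subnK // -ltnS.
  by rewrite sumr_const card_ord mulr_natl.
have qcvg : csum (q h) @[h --> (0 : K)^'] --> csum (q 0).
  apply: (cvg_csum_dominated Ksum (C := C * M * 2)).
  - by apply: filterS near_dom => h /ltW hs; apply: half_bounded_difference_quotient.
  - by apply: half_bounded_difference_quotient; rewrite ?add0r.
  - move=> n; apply: cvgM; first exact: cvg_cst.
    apply: cvg_big => [|i _]; first exact: add_continuous.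
    apply: cvgM; last exact: cvg_cst.
    have : (h + s) @[h --> (0 : K)^'] --> 0 + s.
      apply: cvgD; last exact: cvg_cst.
      exact: cvg_within.
    move=> hs; elim: (n.-1 - i)%N => [|k IHk].
      by under eq_fun do rewrite expr0; exact: cvg_cst.
    by rewrite exprS; under eq_fun do rewrite exprS; apply: cvgM.
apply: cvg_trans qcvg; apply: near_eq_cvg.
have := near_dom; apply: filterS2 (nbhs_dnbhs_neq (0 : K)) => h h0 /ltW hs.
rewrite -(csumB Ksum (half_bounded_power uM (M24 _ hs))
                     (half_bounded_power uM (M24 _ M4s))).
have qE n : u n * (h + s) ^+ n - u n * s ^+ n = h * q h n.
  by rewrite -mulrBr subrXX addrK mulrCA.
rewrite (eq_csum qE) (csumZ Ksum (C := C * M * 2)) ?mulKf //.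
exact: half_bounded_difference_quotient.
Qed.

(** The radius is tied to the growth rate M of the coefficients, so that the
    terms stay dominated by a geometric series of ratio 1/4. *)
Definition has_power_series f u := exists C M,
  exp_bounded C M u /\
  forall s, 4 * M * `|s| < 1 -> f s = csum (fun n => u n * s ^+ n).

Lemma exp_bounded_derivative C M u : exp_bounded C M u ->
  exp_bounded (C * M) (2 * M) (fun n => n.+1%:R * u n.+1).
Proof.
move=> uM; have C0 := exp_bounded_ge0 uM; have M0 := uM.1.
split=> [|n]; first by rewrite mulr_ge0.
rewrite normrM ger0_norm ?ler0n // exprMn.
have -> : C * M * (2 ^+ n * M ^+ n) = 2 ^+ n * (C * M ^+ n.+1).
  by rewrite exprS; ring.
apply: ler_pM => //; last exact: uM.2.
by rewrite -natrX ler_nat ltn_expl.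
Qed.

Lemma has_power_series_derive1 f u : has_power_series f u ->
  has_power_series (derive1 f) (fun n => n.+1%:R * u n.+1).
Proof.
move=> [C [M [uM fu]]]; have C0 := exp_bounded_ge0 uM; have M0 := uM.1.
exists (C * M), (2 * M); split; first exact: exp_bounded_derivative.
move=> s; rewrite mulrA -natrM => Ms; apply: cvg_lim => //.
apply: cvg_trans (cvg_power_series_difference_quotient uM Ms).
apply: near_eq_cvg.
apply: filterS (near_power_series_domain M0 Ms) => h hs /=.
have Mle : 4 * M * `|s| <= 8 * M * `|s|.
  by rewrite -!mulrA ler_wpM2r ?mulr_ge0 // ler_nat.
by rewrite !fu // (le_lt_trans Mle).
Qed.

Lemma taylor_coef_power_series f u n :
  has_power_series f u -> taylor_coef f n = u n.
Proof.
move=> fu; rewrite /taylor_coef.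
suff -> : derive1n n f 0 = n`!%:R * u n.
  by rewrite mulrC mulKf // pnatr_eq0 -lt0n fact_gt0.
elim: n f u fu => [|n IHn] f u fu; last first.
  rewrite derive1Sn (IHn _ _ (has_power_series_derive1 fu)) factS natrM mulrA.
  by rewrite [n.+1%:R * _]mulrC.
case: fu => [C [M [uM fu]]]; rewrite derive1n0 fu ?normr0 ?mulr0 ?ltr01 //.
rewrite (@csum_finite _ _ 1) ?big_nat1 ?expr0 ?mulr1 ?mul1r // => -[//|k] _.
by rewrite expr0n mulr0.
Qed.

Lemma hypergeometrization_power_series f u a c z : has_power_series f u ->
  hypergeometrization a c f z =
  csum (fun n => pochhammer a n / pochhammer c n * u n * z ^+ n).
Proof.
by move=> fu; apply: eq_csum => n; rewrite (taylor_coef_power_series _ fu).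
Qed.

End PowerSeries.

(** * The operators on double power series in tx and ty *)

Section Expansions.
Variable K : numFieldType.
Hypothesis Ksum : sums_half_bounded K.
Implicit Types (F : K -> K -> K -> K) (v w : nat -> nat -> K).
Implicit Types (C M L t x y X Y a c : K) (j k n : nat).

Definition monomials v X Y j k := v j k * X ^+ j * Y ^+ k.

Definition biexp_bounded C M v :=
  0 <= M /\ forall j k, `|v j k| <= C * M ^+ (j + k).

Lemma biexp_bounded_ge0 C M v : biexp_bounded C M v -> 0 <= C.
Proof. by move=> [_ /(_ 0 0)%N]; rewrite expr0 mulr1; apply: le_trans. Qed.

Lemma quarter_bounded_monomials C M v X Y : biexp_bounded C M v ->
  4 * M * `|X| <= 1 -> 4 * M * `|Y| <= 1 -> quarter_bounded C (monomials v X Y).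
Proof.
move=> vM MX MY j k; have C0 := biexp_bounded_ge0 vM; case: vM => M0 vM.
rewrite /monomials !normrM !normrX -mulrA.
apply: (@le_trans _ _ (C * M ^+ (j + k) * (`|X| ^+ j * `|Y| ^+ k))).
  by rewrite ler_wpM2r // mulr_ge0 // exprn_ge0.
rewrite -mulrA ler_wpM2l // !exprD mulrACA.
by rewrite ler_pM ?mulr_ge0 ?exprn_ge0 ?scaled_power_le_quarter.
Qed.

(** The domain only constrains the products tx and ty, so that t may be a
    constant such as 1. The factor 8, where 4 would make the series converge,
    is what the power series in x and in t need: their coefficients are bounded
    with 2M in place of M. *)
Definition has_expansion F v := exists C M, biexp_bounded C M v /\
  forall t x y, 8 * M * `|t * x| < 1 -> 8 * M * `|t * y| < 1 ->
  F t x y = double_series (monomials v (t * x) (t * y)).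

(** Exchanging x and y transfers every statement about hyp_x to hyp_y. *)
Lemma has_expansion_swap F v : has_expansion F v ->
  has_expansion (fun t x y => F t y x) (fun j k => v k j).
Proof.
move=> [C [M [vM Fv]]]; exists C, M; split.
  by case: vM => M0 vM; split=> // j k; rewrite addnC.
move=> t x y Mx My; rewrite Fv // double_seriesC.
by apply: eq_double_series => j k; rewrite /monomials mulrAC.
Qed.

Definition pochhammer_ratio a c n : K := pochhammer a n / pochhammer c n.

Definition ratio_bounded L a c :=
  1 <= L /\ forall n, `|pochhammer_ratio a c n| <= L ^+ n.

Lemma scaled_lt1_widen M p q (X : K) : 0 <= M -> (p <= q)%N ->
  q%:R * M * `|X| < 1 -> p%:R * M * `|X| < 1.
Proof.
move=> M0 pq; apply: le_lt_trans.
by rewrite -!mulrA ler_wpM2r ?mulr_ge0 // ler_nat.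
Qed.

Lemma scaled_lt1_factor L M p (X : K) : 1 <= L -> 0 <= M ->
  p%:R * (L * M) * `|X| < 1 -> p%:R * M * `|X| < 1.
Proof.
move=> L1 M0; apply: le_lt_trans; rewrite ler_wpM2r //.
by rewrite ler_wpM2l // -[leLHS]mul1r ler_wpM2r.
Qed.

Lemma biexp_bounded_ratio L C M v w : 1 <= L -> biexp_bounded C M v ->
  (forall j k, `|w j k| <= L ^+ (j + k)) ->
  biexp_bounded C (L * M) (fun j k => w j k * v j k).
Proof.
move=> L1 [M0 vM] wL; split; first by rewrite mulr_ge0 // (le_trans ler01).
move=> j k; rewrite normrM exprMn mulrCA ler_pM //.
Qed.

(** For fixed t and y, summation by rows gives a power series in x whose j-th
    coefficient carries the j-th row of v. *)
Lemma has_expansion_hyp_x F v a c L : ratio_bounded L a c ->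
  has_expansion F v ->
  has_expansion (hyp_x a c F) (fun j k => pochhammer_ratio a c j * v j k).
Proof.
move=> [L1 aL] [C [M [vM Fv]]].
have L0 : 0 <= L by apply: le_trans L1.
have C0 := biexp_bounded_ge0 vM; have M0 := vM.1.
have rvM : biexp_bounded C (L * M) (fun j k => pochhammer_ratio a c j * v j k).
  apply: biexp_bounded_ratio => // j k; apply: le_trans (aL j) _.
  by rewrite ler_weXn2l // leq_addr.
exists C, (L * M); split=> // t x y LMx LMy.
have Mx := scaled_lt1_factor L1 M0 LMx; have My := scaled_lt1_factor L1 M0 LMy.
set Y := t * y in LMy My *.
have M2Y : 2 * M * `|Y| <= 1 by apply/ltW/(@scaled_lt1_widen M 2 8) => //.
have rowC j : half_bounded (C * M ^+ j) (fun k => v j k * Y ^+ k).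
  move=> k; rewrite normrM normrX.
  apply: (@le_trans _ _ (C * M ^+ (j + k) * `|Y| ^+ k)).
    by rewrite ler_wpM2r ?exprn_ge0 // vM.2.
  rewrite exprD mulrA -mulrA ler_wpM2l ?mulr_ge0 ?exprn_ge0 //.
  exact: scaled_power_le_half.
pose u j := t ^+ j * csum (fun k => v j k * Y ^+ k).
have Fu : has_power_series (fun s => F t s y) u.
  exists (C * 2), (2 * M * `|t|); split.
    split=> [|j]; first by rewrite !mulr_ge0.
    rewrite /u normrM normrX mulrC [(2 * _ * _) ^+ j]exprMn mulrA.
    rewrite ler_wpM2r ?exprn_ge0 //.
    apply: le_trans (csum_norm_le Ksum (rowC j)) _; rewrite mulrAC.
    rewrite ler_wpM2l ?mulr_ge0 // exprMn -[leLHS]mul1r.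
    by rewrite ler_wpM2r ?exprn_ge0 // exprn_ege1 // ler1n.
  move=> s sM; have Ms : 8 * M * `|t * s| < 1.
    have -> : 8 * M * `|t * s| = 4 * (2 * M * `|t|) * `|s| by rewrite normrM; ring.
    exact: sM.
  rewrite Fv // (double_series_rows Ksum (C := C)); last first.
    apply: quarter_bounded_monomials vM _ _;
    by apply/ltW/(@scaled_lt1_widen M 4 8).
  apply: eq_csum => j; rewrite /u mulrAC -exprMn -(csumZ Ksum _ (rowC j)).
  by apply: eq_csum => k; rewrite /monomials mulrA [v j k * _]mulrC.
rewrite /hyp_x (hypergeometrization_power_series Ksum _ _ _ Fu).
rewrite (double_series_rows Ksum (C := C)); last first.
  apply: quarter_bounded_monomials rvM _ _;
  by apply/ltW/(@scaled_lt1_widen _ 4 8) => //; rewrite mulr_ge0.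
apply: eq_csum => j.
have -> : pochhammer a j / pochhammer c j * u j * x ^+ j =
   pochhammer_ratio a c j * (t * x) ^+ j * csum (fun k => v j k * Y ^+ k).
  by rewrite exprMn /u /pochhammer_ratio; ring.
rewrite -(csumZ Ksum _ (rowC j)); apply: eq_csum => k.
by rewrite /monomials; ring.
Qed.

Lemma has_expansion_hyp_y F v a c L : ratio_bounded L a c ->
  has_expansion F v ->
  has_expansion (hyp_y a c F) (fun j k => pochhammer_ratio a c k * v j k).
Proof.
move=> aL /has_expansion_swap /(has_expansion_hyp_x aL).
exact: has_expansion_swap.
Qed.

(** For fixed x and y, summation by antidiagonals gives a power series in t
    whose n-th coefficient is homogeneous of degree n in x and y. *)
Lemma has_expansion_hyp_t F v a c L : ratio_bounded L a c ->
  has_expansion F v ->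
  has_expansion (hyp_t a c F) (fun j k => pochhammer_ratio a c (j + k) * v j k).
Proof.
move=> [L1 aL] [C [M [vM Fv]]].
have L0 : 0 <= L by apply: le_trans L1.
have C0 := biexp_bounded_ge0 vM; have M0 := vM.1.
have rvM : biexp_bounded C (L * M) (fun j k => pochhammer_ratio a c (j + k) * v j k).
  by apply: biexp_bounded_ratio => // j k; exact: aL.
exists C, (L * M); split=> // t x y LMx LMy.
pose u n := \sum_(0 <= j < n.+1) v j (n - j)%N * x ^+ j * y ^+ (n - j).
set m := `|x| + `|y|; have m0 : 0 <= m by rewrite addr_ge0.
have Fu : has_power_series (fun s => F s x y) u.
  exists C, (2 * M * m); split.
    split=> [|n]; first by rewrite !mulr_ge0.
    apply: le_trans (ler_norm_sum _ _ _) _.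
    apply: (@le_trans _ _ (\sum_(0 <= j < n.+1) C * (M ^+ n * m ^+ n))).
      apply: ler_sum_nat => j /andP[_]; rewrite ltnS => jn.
      rewrite !normrM !normrX -mulrA [leRHS]mulrA ler_pM ?mulr_ge0 ?exprn_ge0 //.
        by apply: le_trans (vM.2 _ _) _; rewrite subnKC.
      rewrite -{2}(subnKC jn) exprD ler_pM ?exprn_ge0 //.
        by rewrite lerXn2r ?nnegrE // lerDl.
      by rewrite lerXn2r ?nnegrE // lerDr.
    rewrite sumr_const_nat subn0 -[_ *+ n.+1]mulr_natl mulrCA !exprMn.
    rewrite ler_wpM2l // -mulrA ler_wpM2r ?mulr_ge0 ?exprn_ge0 //.
    by rewrite -natrX ler_nat ltn_expl.
  move=> s sM.
  have Ms z : `|z| <= m -> 8 * M * `|s * z| < 1.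
    move=> zm; apply: le_lt_trans sM; rewrite normrM.
    rewrite [leRHS](_ : _ = 8 * M * (`|s| * m)); last by ring.
    by rewrite ler_wpM2l ?mulr_ge0 // ler_wpM2l.
  have Msx : 8 * M * `|s * x| < 1 by apply: Ms; rewrite lerDl.
  have Msy : 8 * M * `|s * y| < 1 by apply: Ms; rewrite lerDr.
  rewrite Fv // (double_series_antidiagonals Ksum (C := C)); last first.
    apply: quarter_bounded_monomials vM _ _;
    by apply/ltW/(@scaled_lt1_widen M 4 8).
  apply: eq_csum => n; rewrite /u mulr_suml; apply: eq_big_nat => j /andP[_].
  rewrite ltnS => jn; rewrite /monomials !exprMn -[in s ^+ n](subnKC jn) exprD; ring.
rewrite /hyp_t (hypergeometrization_power_series Ksum _ _ _ Fu).
rewrite (double_series_antidiagonals Ksum (C := C)); last first.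
  apply: quarter_bounded_monomials rvM _ _;
  by apply/ltW/(@scaled_lt1_widen _ 4 8) => //; rewrite mulr_ge0.
apply: eq_csum => n; rewrite /u mulr_sumr mulr_suml; apply: eq_big_nat => j /andP[_].
rewrite ltnS => jn; rewrite /monomials !exprMn subnKC //.
rewrite -[in t ^+ n](subnKC jn) exprD /pochhammer_ratio; ring.
Qed.

End Expansions.

(** * Ratios of Pochhammer symbols *)

Section PochhammerRatios.
Variable K : numFieldType.
Implicit Types (a c : K) (n : nat).

Lemma pochhammer0 a : pochhammer a 0 = 1.
Proof. by rewrite /pochhammer big_ord0. Qed.

Lemma pochhammerS a n : pochhammer a n.+1 = pochhammer a n * (a + n%:R).
Proof. by rewrite /pochhammer big_ord_recr. Qed.

Lemma pochhammer_neq0 c n : (forall i : nat, c != - i%:R) -> pochhammer c n != 0.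
Proof.
by move=> hc; apply/prodf_neq0 => i _; rewrite addr_eq0.
Qed.

Lemma pochhammer1 n : pochhammer 1 n = n`!%:R :> K.
Proof.
elim: n => [|n IHn]; first by rewrite pochhammer0.
by rewrite pochhammerS IHn factS natrM mulrC -natr1 addrC.
Qed.

(** The factors (a+i)/(c+i) of the ratio are bounded in i: no denominator
    vanishes, and |c+i| >= i-N for an integer N >= |c|. *)
Lemma ratio_bounded_exists a c :
  (forall x : K, exists N : nat, `|x| <= N%:R) ->
  (forall i : nat, c != - i%:R) -> exists L, ratio_bounded L a c.
Proof.
move=> archi hc; have [A aA] := archi a; have [N cN] := archi c.
pose r i := `|(a + i%:R) / (c + i%:R)|.
pose L := A%:R + 1 + N%:R + \sum_(i < N.+1) r i.
have r0 i : 0 <= r i by exact: normr_ge0.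
have sum0 : 0 <= \sum_(i < N.+1) r i by apply: sumr_ge0.
have L1 : 1 <= L.
  by rewrite /L -!addrA addrCA lerDl !addr_ge0.
have rL i : r i <= L.
  have [iN|Ni] := ltnP i N.+1.
    rewrite /L (bigD1 (Ordinal iN)) //= addrCA lerDl !addr_ge0 //.
    exact: sumr_ge0.
  (* beyond N, numerator and denominator compare through i - N >= 1 *)
  have iN0 : 1 <= i%:R - N%:R :> K by rewrite -natrB 1?ltnW // ler1n subn_gt0.
  have ciN : i%:R - N%:R <= `|c + i%:R|.
    rewrite lerBlDr -[leLHS]normr_nat.
    apply: (@le_trans _ _ (`|c + i%:R| + `|c|)); last by rewrite lerD2l.
    by rewrite -{1}[i%:R](addKr c) addrC ler_normB.
  rewrite /r normrM normfV ler_pdivrMr; last first.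
    by apply: lt_le_trans ciN; apply: lt_le_trans iN0.
  apply: (@le_trans _ _ ((A%:R + 1 + N%:R) * (i%:R - N%:R))); last first.
    apply: ler_pM => //; [exact: le_trans ler01 iN0|].
    by rewrite /L lerDl.
  apply: le_trans (ler_normD _ _) _; rewrite normr_nat.
  apply: (@le_trans _ _ (A%:R + i%:R)); first by rewrite lerD2r.
  have iE : i%:R = (i%:R - N%:R) + N%:R :> K by rewrite subrK.
  rewrite {1}iE; move: iN0; set d := _ - _ => d1.
  rewrite [leRHS](_ : _ = A%:R * d + (d + N%:R * d)); last by ring.
  by rewrite lerD ?lerD2l ?ler_peMr.
exists L; split=> // n; elim: n => [|n IHn].
  by rewrite /pochhammer_ratio !pochhammer0 divr1 normr1 expr0.
rewrite exprSr /pochhammer_ratio !pochhammerS -mulf_div normrM.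
apply: ler_pM => //; exact: rL.
Qed.

End PochhammerRatios.

(** * Summability in the complex plane *)

Section ComplexPlane.
Local Open Scope classical_set_scope.
Variable R : realType.
Local Notation K := (R[i] : numFieldType).
Implicit Types (z w : R[i]) (x y s : R).

Lemma normc_le_parts z :
  `|z| <= (`|complex.Re z| + `|complex.Im z|)%:C :> R[i].
Proof.
case: z => x y /=; have -> : x +i* y = x%:C + 'i * y%:C :> R[i].
  by rewrite [LHS]complexE.
apply: le_trans (ler_normD _ _) _; rewrite normrM rmorphD /=.
by rewrite !normc_def /= !expr0n /= !expr1n !addr0 add0r sqrtr1 mul1r !sqrtr_sqr.
Qed.

Lemma gt0_complexE (e : R[i]) : 0 < e -> exists2 x, 0 < x & e = x%:C.
Proof.
move=> e0; exists (complex.Re e); first by move: e0; rewrite ltcE => /andP[].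
by rewrite RRe_real // gtr0_real.
Qed.

Lemma ge0_complexE (e : R[i]) : 0 <= e -> exists2 x, 0 <= x & e = x%:C.
Proof.
move=> e0; exists (complex.Re e); first by move: e0; rewrite lecE => /andP[].
by rewrite RRe_real // ger0_real.
Qed.

Lemma cvg_complex (T : Type) (F : set_system T) {FF : Filter F}
    (f g : T -> R) x y : f @ F --> x -> g @ F --> y ->
  (fun t => f t +i* g t : K) @ F --> (x +i* y : K).
Proof.
move=> fx gy; apply/cvgrPdist_le => e /gt0_complexE[d d0 ->].
have d20 : 0 < d / 2 by rewrite divr_gt0.
move/cvgrPdist_le: fx => /(_ _ d20); move/cvgrPdist_le: gy => /(_ _ d20).
apply: filterS2 => t gt ft; apply: le_trans (normc_le_parts _) _.
by rewrite lecR /= [leRHS](splitr d) lerD.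
Qed.

Lemma cvg_Re_Im (T : Type) (F : set_system T) {FF : Filter F}
    (f : T -> K) (z : K) : f @ F --> z ->
  (fun t => complex.Re (f t)) @ F --> complex.Re z /\
  (fun t => complex.Im (f t)) @ F --> complex.Im z.
Proof.
have ImRe w : complex.Im w = - complex.Re (w * 'i) by rewrite ReiNIm opprK.
have Re_cvg (g : T -> K) (w : K) : g @ F --> w ->
    (fun t => complex.Re (g t)) @ F --> complex.Re w.
  move=> gw; apply/cvgrPdist_le => e e0.
  have eC : 0 < e%:C :> K by rewrite ltcR.
  move/cvgrPdist_le: gw => /(_ _ eC); apply: filterS => t gt.
  by rewrite -lecR -raddfB /=; apply: le_trans gt; exact: normc_ge_Re.
move=> fz; split; first exact: Re_cvg.
rewrite (_ : (fun t => _) = fun t => - complex.Re (f t * 'i)); last first.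
  by apply/funext => t; rewrite ImRe.
rewrite (ImRe z); apply: cvgN; apply: (Re_cvg (fun t => f t * 'i)).
by apply: (@cvgM K); [exact: fz|exact: cvg_cst].
Qed.

Lemma series_Re_Im (u : nat -> R[i]) n :
  series u n =
  series (fun k => complex.Re (u k)) n +i* series (fun k => complex.Im (u k)) n.
Proof.
rewrite /series /=; elim: n => [|n IHn]; first by rewrite !big_nil.
by rewrite !big_nat_recr //= IHn; case: (u n).
Qed.

Lemma cvg_series_half_bounded (u : nat -> R) x :
  (forall n, `|u n| <= x * 2^-1 ^+ n) -> cvgn (series u).
Proof.
move=> ux; apply: normed_cvg.
apply: (@series_le_cvg _ _ (geometric x 2^-1)) => //.
- by move=> n; apply: normr_ge0.
- by move=> n; apply: le_trans (ux n).
- by apply: is_cvg_geometric_series; rewrite ger0_norm ?invf_lt1 ?ltr1n.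
Qed.

Lemma complex_sums_half_bounded : sums_half_bounded K.
Proof.
move=> C u uC; have /ge0_complexE[x x0 CE] := half_bounded_ge0 uC.
have half_real n : (2^-1 : K) ^+ n = (2^-1 ^+ n)%:C.
  by rewrite rmorphXn /= fmorphV rmorph_nat.
have uR n : `|complex.Re (u n)| <= x * 2^-1 ^+ n.
  rewrite -lecR rmorphM /= -half_real -CE.
  exact: le_trans (normc_ge_Re _) (uC n).
have uI n : `|complex.Im (u n)| <= x * 2^-1 ^+ n.
  rewrite -normrN -ReiNIm -lecR rmorphM /= -half_real -CE.
  apply: le_trans (normc_ge_Re _) _; apply: le_trans (uC n).
  by rewrite normrM (normc_def 'i) /= expr0n expr1n add0r sqrtr1 mulr1.
have cR := @cvg_series_half_bounded (fun k => complex.Re (u k)) _ uR.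
have cI := @cvg_series_half_bounded (fun k => complex.Im (u k)) _ uI.
have := cvg_complex cR cI; rewrite -(funext (@series_Re_Im u)) => ul.
by apply/cvg_ex; eexists; exact: ul.
Qed.

Lemma complex_archi z : exists N : nat, `|z| <= N%:R.
Proof.
have /ge0_complexE[x x0 ->] := normr_ge0 z.
exists (Num.bound x); rewrite -[_%:R](rmorph_nat (real_complex R)) lecR.
exact/ltW/archi_boundP.
Qed.

End ComplexPlane.

(** * Exponential and logarithm along real paths *)

Section ComplexPaths.
Local Open Scope classical_set_scope.
Variable R : realType.
Local Notation K := (R[i] : numFieldType).
Implicit Types (z w b : R[i]) (x y s : R) (p q : R -> R[i]).

Lemma is_derive_cvg (f : R -> R) s x :
  h^-1 * (f (h + s) - f s) @[h --> (0 : R)^'] --> x -> is_derive s 1 f x.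
Proof.
move=> fx.
have E : (fun h : R => h^-1 *: ((f \o shift s) (h *: 1) - f s)) =
         (fun h => h^-1 * (f (h + s) - f s)).
  by apply/funext => h /=; rewrite -[h *: 1]/(h * 1) mulr1.
split; first by rewrite /derivable E; apply/cvg_ex; exists x.
by rewrite /derive E; apply: cvg_lim.
Qed.

(** By components, so that the calculus of one real variable applies. *)
Definition is_path_derive p s w :=
  is_derive s 1 (fun x => complex.Re (p x)) (complex.Re w) /\
  is_derive s 1 (fun x => complex.Im (p x)) (complex.Im w).

(** The link with complex difference quotients of power series. *)
Lemma is_path_derive_cvg p s w :
  (h%:C^-1 : K) * (p (h + s) - p s) @[h --> (0 : R)^'] --> (w : K) ->
  is_path_derive p s w.
Proof.
move=> /cvg_Re_Im[pR pI]; split; apply: is_derive_cvg.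
- apply: cvg_trans pR; apply: near_eq_cvg; apply: nearW => h /=.
  by rewrite -fmorphV /= -raddfB; case: (p _ - p _) => u v /=; rewrite mul0r subr0.
- apply: cvg_trans pI; apply: near_eq_cvg; apply: nearW => h /=.
  by rewrite -fmorphV /= -raddfB; case: (p _ - p _) => u v /=; rewrite mul0r addr0.
Qed.

Lemma is_path_deriveM p q s w z : is_path_derive p s w -> is_path_derive q s z ->
  is_path_derive (fun x => p x * q x) s (p s * z + w * q s).
Proof.
move=> [pR pI] [qR qI]; split.
- have H := is_deriveB (is_deriveM pR qR) (is_deriveM pI qI).
  have -> : (fun x => complex.Re (p x * q x)) =
    (fun x => complex.Re (p x)) * (fun x => complex.Re (q x)) -
    (fun x => complex.Im (p x)) * (fun x => complex.Im (q x)).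
    by apply/funext => x; rewrite !fctE; case: (p x) (q x) => ? ? [].
  apply: (is_derive_eq H); rewrite /GRing.scale /=; clear pR pI qR qI H.
  by case: (p s) (q s) w z => ? ? [? ?] [? ?] [? ?] /=; ring.
- have H := is_deriveD (is_deriveM pR qI) (is_deriveM pI qR).
  have -> : (fun x => complex.Im (p x * q x)) =
    (fun x => complex.Re (p x)) * (fun x => complex.Im (q x)) +
    (fun x => complex.Im (p x)) * (fun x => complex.Re (q x)).
    by apply/funext => x; rewrite !fctE; case: (p x) (q x) => ? ? [].
  apply: (is_derive_eq H); rewrite /GRing.scale /=; clear pR pI qR qI H.
  by case: (p s) (q s) w z => ? ? [? ?] [? ?] [? ?] /=; ring.
Qed.

Lemma is_path_derive_cst z s : is_path_derive (fun=> z) s 0.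
Proof. by split; exact: is_derive_cst. Qed.

Lemma is_path_derive_cexp p s w : is_path_derive p s w ->
  is_path_derive (fun x => cexp (p x)) s (w * cexp (p s)).
Proof.
move=> [pR pI].
have E := is_derive1_comp (is_derive_expR _) pR.
have C := is_derive1_comp (is_derive_cos _) pI.
have S := is_derive1_comp (is_derive_sin _) pI.
split.
- have H := is_deriveM E C.
  have -> : (fun x => complex.Re (cexp (p x))) =
    (expR \o (fun x => complex.Re (p x))) * (cos \o (fun x => complex.Im (p x))).
    by apply/funext => x; rewrite !fctE /cexp /= mul0r subr0.
  apply: (is_derive_eq H); rewrite /GRing.scale /= /cexp; clear pR pI E C S H.
  by case: (p s) w => ? ? [? ?] /=; ring.
- have H := is_deriveM E S.
  have -> : (fun x => complex.Im (cexp (p x))) =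
    (expR \o (fun x => complex.Re (p x))) * (sin \o (fun x => complex.Im (p x))).
    by apply/funext => x; rewrite !fctE /cexp /= mul0r addr0.
  apply: (is_derive_eq H); rewrite /GRing.scale /= /cexp; clear pR pI E C S H.
  by case: (p s) w => ? ? [? ?] /=; ring.
Qed.

(** On the right half-plane the argument is an arctangent, which is what makes
    the principal logarithm differentiable there. *)
Lemma carg_atan z : 0 < complex.Re z ->
  carg z = atan (complex.Im z / complex.Re z).
Proof.
case: z => x y /= x0; rewrite /carg /=.
have cosE : x / Num.sqrt (x ^+ 2 + y ^+ 2) = cos (atan (y / x)).
  rewrite cos_atan; have -> : x ^+ 2 + y ^+ 2 = x ^+ 2 * (1 + (y / x) ^+ 2).
    by field; rewrite gt_eqF.
  rewrite sqrtrM ?sqr_ge0 // sqrtr_sqr gtr0_norm // invfM mulrA divff ?mul1r //.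
  by rewrite gt_eqF.
rewrite cosE; have pi0 := pi_ge0 R.
have := atan_ltpi2 (y / x); have := atan_gtNpi2 (y / x).
case: ifPn => [y0|]; last rewrite -ltNge => y0; move=> lb ub.
  have a0 : 0 <= atan (y / x).
    by rewrite -(@atan0 R) le_atan // divr_ge0 // ltW.
  by rewrite cosK // in_itv /= a0 /=; lra.
have a0 : atan (y / x) <= 0.
  by rewrite -(@atan0 R) le_atan // pmulr_lle0 ?ltW // invr_gt0.
by rewrite cosKN ?opprK // a0 andbT; lra.
Qed.

Lemma is_path_derive_clog p s w : 0 < complex.Re (p s) ->
  is_path_derive p s w -> is_path_derive (fun x => clog (p x)) s (w / p s).
Proof.
move=> ps0 [pR pI].
pose u x := complex.Re (p x); pose v x := complex.Im (p x).
have n0 : 0 < u s ^+ 2 + v s ^+ 2 by rewrite ltr_wpDr ?sqr_ge0 // exprn_gt0.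
have u0 : u s != 0 by rewrite gt_eqF.
split.
- have H2 := is_deriveD (is_deriveM pR pR) (is_deriveM pI pI).
  have n0' : 0 < ((u * u) + (v * v)) s by rewrite !fctE -!expr2.
  have r0 : 0 < (Num.sqrt \o ((u * u) + (v * v))) s by rewrite /= sqrtr_gt0.
  have H := is_derive1_comp (is_derive1_ln r0)
                            (is_derive1_comp (is_derive1_sqrt n0') H2).
  have -> : (fun x => complex.Re (clog (p x))) =
      (@ln R \o (Num.sqrt \o ((u * u) + (v * v)))).
    by apply/funext => x /=; rewrite !fctE /u /v -!expr2; case: (p x).
  apply: (is_derive_eq H); rewrite /=.
  have sq : Num.sqrt ((u * u + v * v) s) ^+ 2 = u s ^+ 2 + v s ^+ 2.
    by rewrite sqr_sqrtr ?ltW // !fctE -!expr2.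
  have sq0 : Num.sqrt ((u * u + v * v) s) != 0 by rewrite gt_eqF ?sqrtr_gt0.
  move: sq sq0; set r := Num.sqrt _ => sq rn0.
  rewrite mulrA [2 * r]mulrC invfM mulrA -invfM -expr2 sq.
  rewrite /GRing.scale /= /u /v.
  move: n0 u0; rewrite /u /v; clear -p s w; case: (p s) w => ? ? [? ?] /= n0 u0.
  by field; rewrite gt_eqF.
- have H := is_derive1_comp (is_derive1_atan _) (is_deriveM pI (is_deriveV u0 pR)).
  apply: (@near_eq_is_derive _ _ _ (atan \o ((fun x => complex.Im (p x)) *
          (fun x => (complex.Re (p x))^-1)))).
    have cu : {for s, continuous u}.
      by apply: differentiable_continuous; apply/derivable1_diffP; case: pR.
    have := cvgr_gt _ cu _ ps0 => /(_ (nbhs_filter s)); apply: filterS => x ux.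
    by rewrite /= !fctE carg_atan.
  apply: (is_derive_eq H); rewrite !fctE /GRing.scale /=.
  move: n0 u0; rewrite /u /v; clear -p s w; case: (p s) w => ? ? [? ?] /= n0 u0.
  by field; rewrite u0 gt_eqF.
Qed.

(** The mean value theorem for the two components. *)
Lemma path_constant p : (forall s, 0 <= s <= 1 -> is_path_derive p s 0) ->
  p 1 = p 0.
Proof.
move=> p0.
have cst (f : R -> R) : (forall s, 0 <= s <= 1 -> is_derive s 1 f 0) -> f 1 = f 0.
  move=> f0; have [|||c _] := @MVT R f (fun=> 0) 0 1.
  - exact: ltr01.
  - by move=> x; rewrite in_itv /= => /andP[/ltW a /ltW c]; apply: f0; rewrite a c.
  - apply: continuous_in_subspaceT => x; rewrite inE /= in_itv /= => /f0 fx.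
    by apply: differentiable_continuous; apply/derivable1_diffP; case: fx.
  - by rewrite mul0r => /eqP; rewrite subr_eq0 => /eqP.
have Re1 := cst _ (fun s h => (p0 s h).1).
have Im1 := cst _ (fun s h => (p0 s h).2).
by case: (p 1) (p 0) Re1 Im1 => ? ? [? ?] /= -> ->.
Qed.

Lemma cexpN z : cexp (- z) * cexp z = 1.
Proof.
case: z => x y; rewrite /cexp /= cosN sinN expRN.
have e0 : expR x != 0 by rewrite gt_eqF ?expR_gt0.
apply/eqP; rewrite eq_complex /=; apply/andP; split; apply/eqP; last by ring.
rewrite [LHS](_ : _ = (expR x)^-1 * expR x * (cos y ^+ 2 + sin y ^+ 2)).
  by rewrite cos2Dsin2 mulVf ?mulr1.
by ring.
Qed.

Lemma clog1 : clog 1 = 0 :> R[i].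
Proof.
rewrite /clog carg_atan //= expr1n expr0n addr0 sqrtr1 ln1 mul0r atan0.
by [].
Qed.

Lemma cexp0 : cexp 0 = 1 :> R[i].
Proof. by rewrite /cexp /= expR0 cos0 sin0 mul1r. Qed.

End ComplexPaths.

(** * The binomial series *)

Section BinomialSeries.
Local Open Scope classical_set_scope.
Variable R : realType.
Local Notation K := (R[i] : numFieldType).
Implicit Types (z w b L : K) (s : R).

Let Ksum := @complex_sums_half_bounded R.

Definition binomial_series b z : K :=
  csum (fun n => pochhammer_ratio b 1 n * z ^+ n).

Definition binomial_series_derivative b z : K :=
  csum (fun n => n.+1%:R * pochhammer_ratio b 1 n.+1 * z ^+ n).

Lemma pochhammer_ratio1S b n :
  n.+1%:R * pochhammer_ratio b 1 n.+1 = (b + n%:R) * pochhammer_ratio b 1 n.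
Proof.
rewrite /pochhammer_ratio !pochhammerS -natr1.
have n0 : pochhammer 1 n != 0 :> K by rewrite pochhammer1 pnatr_eq0 -lt0n fact_gt0.
have n10 : 1 + n%:R != 0 :> K by rewrite addrC natr1 pnatr_eq0.
by field; rewrite n0 n10.
Qed.

Lemma exp_bounded_ratio b L : ratio_bounded L b 1 ->
  exp_bounded 1 L (pochhammer_ratio b 1).
Proof.
by move=> [L1 bL]; split=> [|n]; [exact: le_trans L1|rewrite mul1r bL].
Qed.

(** The differential equation of the power function, read off the recurrence of
    the coefficients. *)
Lemma binomial_series_ode b L w : ratio_bounded L b 1 -> 8 * L * `|w| < 1 ->
  (1 - w) * binomial_series_derivative b w = b * binomial_series b w.
Proof.
move=> bL Lw; have uL := exp_bounded_ratio bL; have L0 := uL.1.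
set u := pochhammer_ratio b 1 in uL *.
have dL := exp_bounded_derivative uL.
have eL : exp_bounded 1 (2 * L) (fun n => n%:R * u n).
  split=> [|n]; first by rewrite mulr_ge0.
  rewrite normrM normr_nat mul1r exprMn ler_pM //.
    by rewrite -natrX ler_nat ltnW // ltn_expl.
  by have := uL.2 n; rewrite mul1r.
have w2 : 2 * L * `|w| <= 1 by apply/ltW/(@scaled_lt1_widen _ L 2 8).
have w4 : 2 * (2 * L) * `|w| <= 1.
  by rewrite mulrA -natrM; apply/ltW/(@scaled_lt1_widen _ L 4 8).
have dw := half_bounded_power dL w4; have ew := half_bounded_power eL w4.
have uw := half_bounded_power uL w2.
rewrite mulrBl mul1r.
have -> : w * binomial_series_derivative b w = csum (fun n => n%:R * u n * w ^+ n).
  rewrite (csum_shift Ksum ew) ?mul0r // -(csumZ Ksum _ dw).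
  by apply: eq_csum => n; rewrite exprS mulrCA.
rewrite -(csumB Ksum dw ew) -(csumZ Ksum _ uw); apply: eq_csum => n.
by rewrite /u pochhammer_ratio1S; ring.
Qed.

(** Increments along a ray are nonzero complex increments tending to 0, so a
    complex derivative restricts to the ray. *)
Lemma cvg_ray z : z != 0 ->
  (h%:C * z : K) @[h --> (0 : R)^'] --> (0 : K)^'.
Proof.
move=> z0 A A0.
have hz : (h%:C * z : K) @[h --> (0 : R)] --> (0 : K).
  rewrite -[X in _ --> X](mul0r z); apply: (@cvgM K); last exact: cvg_cst.
  exact: (@cvg_complex R _ _ _ id (fun=> 0) 0 0 (@cvg_id _ _) (@cvg_cst _ _ _ _ _)).
change (nbhs (0 : R) (fun h => h != 0 -> A (h%:C * z))).
have := hz (fun w => w != 0 -> A w) A0.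
apply: (@filterS _ (nbhs (0 : R)) (nbhs_filter _)) => h Ah h0; apply: Ah.
by rewrite mulf_neq0 // (inj_eq (@complexI R) h 0).
Qed.

Lemma is_path_derive_binomial_series b L z s : ratio_bounded L b 1 ->
  8 * L * `|s%:C * z| < 1 ->
  is_path_derive (fun x => binomial_series b (x%:C * z)) s
    (z * binomial_series_derivative b (s%:C * z)).
Proof.
move=> bL Lsz; have [->|z0] := eqVneq z 0.
  rewrite mul0r (_ : (fun x => _) = fun=> binomial_series b 0).
    exact: is_path_derive_cst.
  by apply/funext => x; rewrite mulr0.
apply: is_path_derive_cvg.
have := cvg_power_series_difference_quotient Ksum (exp_bounded_ratio bL) Lsz.
move=> /(cvg_comp _ _ (cvg_ray z0)) H.
have zH : (z * ((h%:C * z)^-1 * (binomial_series b (h%:C * z + s%:C * z) -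
    binomial_series b (s%:C * z))) : K) @[h --> (0 : R)^'] -->
    (z * binomial_series_derivative b (s%:C * z) : K).
  by apply: (@cvgM K); [exact: cvg_cst|exact: H].
apply: cvg_trans zH; apply: near_eq_cvg.
apply: nearW => h /=.
by rewrite rmorphD mulrDl invfM (mulrC h%:C^-1) -mulrA mulVKf.
Qed.

Lemma is_path_derive_segment z s :
  is_path_derive (fun x => 1 - x%:C * z) s (- z).
Proof.
apply: is_path_derive_cvg; apply: cvg_near_cst.
apply: filterS (nbhs_dnbhs_neq (0 : R)) => h h0.
have h0C : h%:C != 0 :> K by rewrite (inj_eq (@complexI R) h 0).
rewrite rmorphD [X in _ * X](_ : _ = h%:C * (- z)) ?mulKf //.
by rewrite mulrDl; ring.
Qed.

(** Along the segment from 0 to z, the product of the binomial series with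
    (1 - w)^b has derivative 0, by the differential equation; it is 1 at 0. *)
Lemma binomial_seriesE b L z : ratio_bounded L b 1 -> 8 * L * `|z| < 1 ->
  binomial_series b z = cpow (1 - z) (- b).
Proof.
move=> bL Lz; have L0 : 0 <= L by apply: le_trans bL.1.
have z1 : `|z| < 1.
  apply: le_lt_trans Lz; rewrite ler_peMl //.
  by rewrite (le_trans bL.1) // ler_peMl // ler1n.
pose p s := binomial_series b (s%:C * z) * cexp (b * clog (1 - s%:C * z)).
have p1 : p 1 = p 0.
  apply: path_constant => s /andP[s0 s1].
  have szz : `|s%:C * z| <= `|z|.
    rewrite normrM ler_piMl // ger0_norm ?ler0c //.
    by rewrite -[1](rmorph1 (real_complex R)) lecR.
  have Lsz : 8 * L * `|s%:C * z| < 1.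
    by apply: le_lt_trans Lz; rewrite ler_wpM2l ?mulr_ge0.
  have Re0 : 0 < complex.Re (1 - s%:C * z).
    have : `|complex.Re (s%:C * z)| < 1.
      rewrite -ltcR; apply: le_lt_trans (normc_ge_Re _) _.
      exact: le_lt_trans szz z1.
    rewrite raddfB /= ltr_norml => /andP[_]; rewrite subr_gt0; exact.
  have d0 : 1 - s%:C * z != 0.
    by apply: contraTneq Re0 => ->; rewrite ltxx.
  have H1 := is_path_derive_binomial_series bL Lsz.
  have H2 := is_path_derive_cexp (is_path_deriveM (is_path_derive_cst b s)
    (is_path_derive_clog Re0 (is_path_derive_segment z s))).
  have := is_path_deriveM H1 H2.
  set D := _ + _ => H; suff <- : D = 0 by exact: H.
  have ode := binomial_series_ode bL Lsz.
  have -> : D = (z * cexp (b * clog (1 - s%:C * z)) / (1 - s%:C * z)) *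
    ((1 - s%:C * z) * binomial_series_derivative b (s%:C * z) -
     b * binomial_series b (s%:C * z)) by rewrite /D; field.
  by rewrite ode subrr mulr0.
have p0 : p 0 = 1.
  rewrite /p mul0r subr0 clog1 mulr0 cexp0 mulr1 /binomial_series.
  rewrite (@csum_finite _ _ 1) => [|[//|n] _]; last by rewrite expr0n mulr0.
  by rewrite big_nat1 expr0 mulr1 /pochhammer_ratio !pochhammer0 divr1.
move: p1; rewrite p0 /p rmorph1 mul1r /cpow mulNr => p1.
have := cexpN (b * clog (1 - z)); set e := cexp (- _) => eE.
by rewrite -[LHS]mulr1 -eE mulrCA p1 mulr1.
Qed.

End BinomialSeries.

(** * The arctangent as a double series *)

Section BinomialExpansion.
Variable K : numFieldType.
Hypothesis Ksum : sums_half_bounded K.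
Implicit Types (u : nat -> K) (C M X Y T : K) (j k n : nat).

Definition binomial_coefs u j k := u (j + k)%N * 'C(j + k, j)%:R.

Lemma biexp_bounded_binomial_coefs C M u : exp_bounded C M u ->
  biexp_bounded C (2 * M) (binomial_coefs u).
Proof.
move=> uM; have C0 := exp_bounded_ge0 uM; case: uM => M0 uM.
split=> [|j k]; first by rewrite mulr_ge0.
rewrite normrM normr_nat exprMn mulrCA [leRHS]mulrC ler_pM //.
rewrite -natrX ler_nat -[2%N]/(1 + 1)%N expnDn.
have jk : (j < (j + k).+1)%N by rewrite ltnS leq_addr.
by rewrite (bigD1 (Ordinal jk)) //= !exp1n !muln1 leq_addr.
Qed.

(** The n-th antidiagonal is the binomial expansion of the n-th term. *)
Lemma power_series_add C M u X Y : exp_bounded C M u ->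
  8 * M * `|X| <= 1 -> 8 * M * `|Y| <= 1 ->
  csum (fun n => u n * (X + Y) ^+ n) =
  double_series (monomials (binomial_coefs u) X Y).
Proof.
move=> uM MX MY; rewrite (double_series_antidiagonals Ksum (C := C)); last first.
  by apply: (quarter_bounded_monomials (biexp_bounded_binomial_coefs uM));
    rewrite mulrA -natrM.
apply: eq_csum => n; rewrite addrC exprDn mulr_sumr big_mkord.
apply: eq_bigr => i _; rewrite /monomials /binomial_coefs subnKC; last first.
  by rewrite -ltnS.
by rewrite -mulr_natr; ring.
Qed.

End BinomialExpansion.

Section ArctanExpansion.
Variable K : numFieldType.
Hypothesis Ksum : sums_half_bounded K.
Implicit Types (u : nat -> K) (C M X Y : K) (j k n : nat).

Definition arctan_coef n : K := (2 * n + 1)%N%:R^-1.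

Definition arctan_expansion_coef j k : K :=
  pochhammer (1 / 2) j * pochhammer (1 / 2) k / pochhammer (3 / 2) (j + k).

Lemma half_neq_oppn i : 1 / 2 != - i%:R :> K.
Proof.
by rewrite -subr_eq0 opprK gt_eqF // ltr_wpDr ?ler0n // divr_gt0 ?ltr01 ?ltr0n.
Qed.

Lemma three_halves_neq_oppn i : 3 / 2 != - i%:R :> K.
Proof.
by rewrite -subr_eq0 opprK gt_eqF // ltr_wpDr ?ler0n // divr_gt0 ?ltr0n.
Qed.

Lemma arctan_expansion_coef_symm j k :
  arctan_expansion_coef j k = arctan_expansion_coef k j.
Proof. by rewrite /arctan_expansion_coef addnC [_ j * _]mulrC. Qed.

Lemma arctan_expansion_coefS j k :
  arctan_expansion_coef j.+1 k =
  (1 / 2 + j%:R) / (3 / 2 + (j + k)%:R) * arctan_expansion_coef j k.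
Proof.
rewrite /arctan_expansion_coef addSn !pochhammerS.
have n0 := pochhammer_neq0 (j + k) three_halves_neq_oppn.
have n1 : 3 / 2 + (j + k)%:R != 0 :> K by rewrite addr_eq0 three_halves_neq_oppn.
move: (1 / 2) (pochhammer (3 / 2) _) (3 / 2 + _) n0 n1 => a p q p0 q0.
by field; rewrite p0 q0.
Qed.

Lemma arctan_expansion_coef_bounds j k : 0 <= arctan_expansion_coef j k <= 1.
Proof.
have half0 : 0 <= 1 / 2 :> K by rewrite divr_ge0 ?ler01 ?ler0n.
have pos i l : 0 < 3 / 2 + (i + l)%:R :> K.
  by rewrite ltr_wpDr ?ler0n // divr_gt0 ?ltr0n.
have step i l : 0 <= arctan_expansion_coef i l <= 1 ->
    0 <= arctan_expansion_coef i.+1 l <= 1.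
  rewrite arctan_expansion_coefS => /andP[c0 c1].
  have q0 : 0 <= (1 / 2 + i%:R) / (3 / 2 + (i + l)%:R) :> K.
    by rewrite divr_ge0 ?addr_ge0 ?ler0n // ltW.
  rewrite mulr_ge0 //=; apply: mulr_ile1 => //; rewrite ler_pdivrMr // [leRHS]mul1r.
  by rewrite lerD ?ler_nat ?leq_addr // ler_pM2r ?invr_gt0 ?ltr0n // ler1n.
elim: j => [|j /step //]; rewrite arctan_expansion_coef_symm.
elim: k => [|k /step //]; rewrite /arctan_expansion_coef !pochhammer0.
by rewrite mul1r divr1 ler01 lexx.
Qed.

Lemma arctan_expansion_coef0 j : arctan_expansion_coef j 0 = arctan_coef j.
Proof.
rewrite /arctan_coef; elim: j => [|j IHj].
  by rewrite /arctan_expansion_coef !pochhammer0 mul1r divr1 invr1.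
rewrite arctan_expansion_coefS IHj addn0.
have n0 : (2 * j + 1)%N%:R != 0 :> K by rewrite pnatr_eq0 addn1.
have n1 : (2 * j.+1 + 1)%N%:R != 0 :> K by rewrite pnatr_eq0 addn1.
have -> : 1 / 2 + j%:R = (2 * j + 1)%N%:R / 2 :> K.
  by rewrite natrD natrM; field.
have -> : 3 / 2 + j%:R = (2 * j.+1 + 1)%N%:R / 2 :> K.
  by rewrite natrD natrM -natr1; field.
move: (2 * j + 1)%N%:R (2 * j.+1 + 1)%N%:R n0 n1 => p q p0 q0.
by field; rewrite p0 q0.
Qed.

(** A sequence stands for a power series in X, of which these are the product by
    1 - X and the derivative. *)
Definition mul_oneBX u n := u n - (if n is n'.+1 then u n' else 0).
Definition deriv_coefs u n := n.+1%:R * u n.+1.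

(** The value at n = 0 of the left-hand side agrees with the formula because the
    missing term has the factor 0. *)
Lemma mul_oneBX_deriv u n :
  mul_oneBX (deriv_coefs u) n = n.+1%:R * u n.+1 - n%:R * u n.
Proof. by case: n => [|n]; rewrite /mul_oneBX /deriv_coefs ?mul0r ?subr0. Qed.

Lemma iter_mul_oneBXZ k (a : K) u n :
  iter k mul_oneBX (fun j => a * u j) n = a * iter k mul_oneBX u n.
Proof.
elim: k n => [|k IHk] [|n] //=; rewrite /mul_oneBX ?IHk ?subr0 //.
by rewrite mulrBr.
Qed.

(** From ((1 - X) u)' = (1 - X) u' - u, by induction on k. *)
Lemma mul_oneBX_deriv_iter k u n :
  mul_oneBX (deriv_coefs (iter k mul_oneBX u)) n =
  iter k.+1 mul_oneBX (deriv_coefs u) n - k%:R * iter k mul_oneBX u n.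
Proof.
elim: k n => [|k IHk] n; first by rewrite mul0r subr0.
have dm v m : deriv_coefs (mul_oneBX v) m = mul_oneBX (deriv_coefs v) m - v m.
  by rewrite mul_oneBX_deriv /deriv_coefs /mul_oneBX -natr1; ring.
rewrite [LHS](_ : _ = mul_oneBX (fun m => iter k.+1 mul_oneBX (deriv_coefs u) m
    - k.+1%:R * iter k mul_oneBX u m) n); last first.
  congr (mul_oneBX _ n); apply/funext => m /=; rewrite dm IHk /= -natr1.
  by ring.
by case: n => [|n]; rewrite /mul_oneBX /=; ring.
Qed.

(** The coefficient of T^k in the arctangent series at X + T, as a power series
    in X. *)
Definition arctan_binomial_row k j : K := binomial_coefs arctan_coef j k.

Lemma deriv_arctan_row k j :
  deriv_coefs (arctan_binomial_row k) j = k.+1%:R * arctan_binomial_row k.+1 j.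
Proof.
rewrite /deriv_coefs /arctan_binomial_row /binomial_coefs addSn addnS.
rewrite mulrCA [RHS]mulrCA; congr (_ * _).
rewrite -!natrM; congr _%:R.
have := mul_bin_left (j + k).+1 j.
by rewrite subSn ?leq_addr // addKn => <-.
Qed.

(** As power series w_k in X, both sides agree for k = 0 and satisfy
    (k+1) w_(k+1) = (1 - X) w_k' + k w_k. *)
Lemma arctan_expansion_row k j :
  arctan_expansion_coef j k = iter k mul_oneBX (arctan_binomial_row k) j.
Proof.
elim: k j => [|k IHk] j.
  rewrite arctan_expansion_coef0 /= /arctan_binomial_row /binomial_coefs.
  by rewrite addn0 binn mulr1.
have k0 : k.+1%:R != 0 :> K by rewrite pnatr_eq0.
apply: (mulfI k0); rewrite -iter_mul_oneBXZ.
have <- : deriv_coefs (arctan_binomial_row k) =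
    fun i => k.+1%:R * arctan_binomial_row k.+1 i.
  by apply/funext => i; exact: deriv_arctan_row.
have := mul_oneBX_deriv_iter k (arctan_binomial_row k) j.
rewrite -(funext IHk) mul_oneBX_deriv => /eqP; rewrite eq_sym subr_eq => /eqP ->.
have jk0 : 3 / 2 + (j + k)%:R != 0 :> K by rewrite addr_eq0 three_halves_neq_oppn.
rewrite arctan_expansion_coef_symm !arctan_expansion_coefS.
rewrite [arctan_expansion_coef k j]arctan_expansion_coef_symm [(k + j)%N]addnC.
(* the recurrence, cleared of the common factor v_jk / (3/2 + j + k) *)
have num : k.+1%:R * (1 / 2 + k%:R) =
    j.+1%:R * (1 / 2 + j%:R) + (k%:R - j%:R) * (3 / 2 + (j + k)%:R) :> K.
  by rewrite natrD -!natr1; field.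
move: (arctan_expansion_coef j k) => v; rewrite !mulrA num.
move: (3 / 2 + _) jk0 => q q0.
by field.
Qed.

Lemma mul_oneBX_power_series C M u X : exp_bounded C M u -> 1 <= M ->
  2 * M * `|X| <= 1 ->
  exp_bounded (C * 2) M (mul_oneBX u) /\
  csum (fun n => mul_oneBX u n * X ^+ n) = (1 - X) * csum (fun n => u n * X ^+ n).
Proof.
move=> uM M1 MX; have C0 := exp_bounded_ge0 uM.
have M0 : 0 <= M by exact: uM.1.
pose su n := if n is n'.+1 then u n' else 0.
have suM : exp_bounded C M su.
  split=> // -[|n]; first by rewrite normr0 mulr_ge0.
  apply: le_trans (uM.2 n) _; rewrite ler_wpM2l //.
  by rewrite exprS ler_peMl ?exprn_ge0.
split.
  split=> // n; apply: le_trans (ler_normB _ _) _.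
  by rewrite mulrAC mulr_natr mulr2n lerD // ?uM.2 // suM.2.
have uX := half_bounded_power uM MX; have suX := half_bounded_power suM MX.
rewrite mulrBl mul1r -(csumZ Ksum _ uX).
have -> : csum (fun n => X * (u n * X ^+ n)) = csum (fun n => su n * X ^+ n).
  rewrite (csum_shift Ksum suX) ?mul0r //.
  by apply: eq_csum => n /=; rewrite exprS mulrCA.
rewrite -(csumB Ksum uX suX); apply: eq_csum => n.
by rewrite -mulrBl.
Qed.

Lemma iter_mul_oneBX_power_series k C M u X : exp_bounded C M u -> 1 <= M ->
  2 * M * `|X| <= 1 ->
  exp_bounded (C * 2 ^+ k) M (iter k mul_oneBX u) /\
  csum (fun n => iter k mul_oneBX u n * X ^+ n) =
  (1 - X) ^+ k * csum (fun n => u n * X ^+ n).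
Proof.
move=> uM M1 MX; elim: k => [|k [IHM IHE]]; first by rewrite expr0 mulr1 expr0 mul1r.
have [kM kE] := mul_oneBX_power_series IHM M1 MX.
split; first by rewrite exprSr mulrA.
by rewrite [LHS]kE IHE mulrA -exprS.
Qed.

Lemma exp_bounded_arctan_coef : exp_bounded 1 1 arctan_coef.
Proof.
split=> [|n]; first exact: ler01.
rewrite expr1n mulr1 normfV normr_nat invf_le1 ?ltr0n ?addn1 //.
by rewrite ler1n.
Qed.

(** The argument is X + Y(1 - X); expanding its powers and summing over the
    exponent of X first, the k-th inner series is Y^k (1 - X)^k times the series
    of arctan_binomial_row k, which arctan_expansion_row identifies. *)
Lemma arctan_series_expansion X Y : 16 * `|X| <= 1 -> 16 * `|Y| <= 1 ->
  csum (fun n => arctan_coef n * (X + Y - X * Y) ^+ n) =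
  double_series (monomials arctan_expansion_coef X Y).
Proof.
move=> X16 Y16.
have le16 (p : nat) (x : K) : (p <= 16)%N -> 16 * `|x| <= 1 -> p%:R * `|x| <= 1.
  by move=> p16; apply: le_trans; rewrite ler_wpM2r // ler_nat.
have X1 : `|1 - X| <= 2.
  apply: le_trans (ler_normB _ _) _; rewrite normr1 -[leRHS]/(1 + 1) lerD2l.
  by have := le16 1%N X isT X16; rewrite mul1r.
have T8 : 8 * `|Y * (1 - X)| <= 1.
  rewrite normrM mulrCA; apply: (@le_trans _ _ (`|Y| * (8 * 2))).
    by rewrite ler_wpM2l // ler_wpM2l.
  by rewrite -natrM mulrC.
have -> : X + Y - X * Y = X + Y * (1 - X) by ring.
have aM := exp_bounded_arctan_coef.
rewrite (power_series_add Ksum aM) ?mulr1 //; last exact: (le16 8).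
rewrite double_seriesC (double_series_rows Ksum (C := 1)); last first.
  move=> k j; rewrite addnC.
  apply: (quarter_bounded_monomials (biexp_bounded_binomial_coefs aM)) => //.
    by rewrite mulr1 -natrM; exact: (le16 8).
  by rewrite mulr1 -natrM.
have cM : biexp_bounded 1 1 arctan_expansion_coef.
  split=> [|j k]; first exact: ler01.
  have /andP[c0 c1] := arctan_expansion_coef_bounds j k.
  by rewrite ger0_norm // expr1n mulr1.
rewrite [RHS]double_seriesC [RHS](double_series_rows Ksum (C := 1)); last first.
  move=> k j; rewrite addnC.
  by apply: (quarter_bounded_monomials cM); rewrite mulr1; exact: (le16 4).
apply: eq_csum => k.
have rowM : exp_bounded (2 ^+ k) 2 (arctan_binomial_row k).
  split=> // j; have := (biexp_bounded_binomial_coefs aM).2 j k.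
  by rewrite mul1r mulr1 exprD mulrC.
have X4 : 2 * 2 * `|X| <= 1 by rewrite -natrM; exact: (le16 4).
have [iM iE] := iter_mul_oneBX_power_series k rowM (ler1n _ _) X4.
transitivity (Y ^+ k *
    ((1 - X) ^+ k * csum (fun j => arctan_binomial_row k j * X ^+ j))).
  rewrite mulrA -exprMn -(csumZ Ksum _ (half_bounded_power rowM X4)).
  by apply: eq_csum => j; rewrite /monomials mulrC.
rewrite -iE -(csumZ Ksum _ (half_bounded_power iM X4)); apply: eq_csum => j.
by rewrite -arctan_expansion_row /monomials mulrC.
Qed.

Lemma has_expansion_arctan : has_expansion
  (fun t x y => arctan_sqrt_div_sqrt (t ^+ 2 * x * y - t * x - t * y))
  arctan_expansion_coef.
Proof.
exists 1, 2; split.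
  split=> // j k; have /andP[c0 c1] := arctan_expansion_coef_bounds j k.
  by rewrite ger0_norm // mul1r (le_trans c1) // exprn_ege1 // ler1n.
move=> t x y; rewrite -natrM => /ltW X16 /ltW Y16.
rewrite -arctan_series_expansion //; apply: eq_csum => n.
rewrite -exprMn mulrC; congr (_ * _ ^+ n); ring.
Qed.

End ArctanExpansion.

(** * Even binomial coefficients *)

Section EvenBinomialExpansion.
Variable K : numFieldType.
Hypothesis Ksum : sums_half_bounded K.
Implicit Types (X Y p q : K) (j k n : nat).

Lemma sum_even_odd (f : nat -> K) n :
  \sum_(0 <= i < n.*2.+1) f i =
  \sum_(0 <= j < n.+1) f j.*2 + \sum_(0 <= j < n) f j.*2.+1.
Proof.
elim: n => [|n IHn]; first by rewrite !big_nat1 big_geq // addr0.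
rewrite doubleS big_nat_recr //= big_nat_recr //= IHn.
rewrite [in RHS]big_nat_recr //= [X in _ = _ + X]big_nat_recr //= doubleS.
by ring.
Qed.

(** The odd terms of (p + q)^(2n) and (p - q)^(2n) cancel in the sum. *)
Lemma sum_even_binomial p q n :
  \sum_(0 <= j < n.+1) 'C(n.*2, j.*2)%:R * (p ^+ 2) ^+ j * (q ^+ 2) ^+ (n - j) =
  (((p + q) ^+ 2) ^+ n + ((p - q) ^+ 2) ^+ n) / 2.
Proof.
have two0 : 2 != 0 :> K by rewrite pnatr_eq0.
apply: (mulIf two0); rewrite divfK // -!exprM mul2n.
have -> : (p - q) ^+ n.*2 = (q - p) ^+ n.*2.
  by rewrite -mul2n !exprM -(sqrrN (p - q)) opprB.
rewrite [p + q]addrC !exprDn -big_split /=.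
rewrite -(big_mkord xpredT (fun i => q ^+ (n.*2 - i) * p ^+ i *+ 'C(n.*2, i) +
   q ^+ (n.*2 - i) * (- p) ^+ i *+ 'C(n.*2, i))) sum_even_odd /=.
rewrite [X in _ = _ + X]big1 ?addr0 => [|i _]; last first.
  by rewrite exprNn -signr_odd /= odd_double /= expr1 mulN1r mulrN mulNrn subrr.
rewrite mulr_suml; apply: eq_big_nat => j /andP[_]; rewrite ltnS => jn.
rewrite -!exprM !mul2n doubleB exprNn -signr_odd odd_double expr0 mul1r.
by rewrite -mulr_natr; ring.
Qed.

Lemma sqr_norm_le (x : K) : `|x ^+ 2| <= 16^-1 -> `|x| <= 4^-1.
Proof.
rewrite normrX; have -> : 16^-1 = 4^-1 ^+ 2 :> K.
  by rewrite exprVn -natrX.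
by rewrite ler_pXn2r // nnegrE // invr_ge0.
Qed.

Lemma biexp_bounded_even_binomial :
  biexp_bounded 1 4 (fun j k => 'C((j + k).*2, j.*2)%:R : K).
Proof.
split=> // j k; rewrite mul1r normr_nat -natrX ler_nat.
rewrite (_ : 4 = (1 + 1) ^ 2)%N // -expnM mul2n expnDn.
have jk : (j.*2 < (j + k).*2.+1)%N by rewrite ltnS leq_double leq_addr.
by rewrite (bigD1 (Ordinal jk)) //= !exp1n !muln1 leq_addr.
Qed.

(** With X = p^2 and Y = q^2, sum_even_binomial turns the sum by antidiagonals
    into two geometric series, of ratios (p + q)^2 and (p - q)^2. *)
Lemma even_binomial_expansion X Y :
  (forall z : K, exists w, w ^+ 2 = z) ->
  16 * `|X| <= 1 -> 16 * `|Y| <= 1 ->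
  double_series (monomials (fun j k => 'C((j + k).*2, j.*2)%:R) X Y) =
  (1 - (X + Y)) / (1 - 2 * (X + Y) + (X - Y) ^+ 2).
Proof.
move=> sqrt X16 Y16; have [p pX] := sqrt X; have [q qY] := sqrt Y.
have small (w z : K) : w ^+ 2 = z -> 16 * `|z| <= 1 -> `|w| <= 4^-1.
  move=> <- z16; apply: sqr_norm_le.
  by rewrite -[leRHS]mul1r ler_pdivlMr ?ltr0n // mulrC.
have p4 := small _ _ pX X16; have q4 := small _ _ qY Y16.
have half_half : 4^-1 = 2^-1 * 2^-1 :> K by rewrite -invfM -natrM.
have sqr4 (w : K) : `|w| <= 2^-1 -> `|w ^+ 2| <= 2^-1.
  move=> w2; rewrite normrX expr2 -[leRHS]mulr1; apply: ler_pM => //.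
  by apply: le_trans w2 _; have := half_le1 K 1; rewrite expr1.
have halfD : 4^-1 + 4^-1 = 2^-1 :> K by field.
have P2 : `|(p + q) ^+ 2| <= 2^-1.
  by apply: sqr4; rewrite -halfD (le_trans (ler_normD _ _)) // lerD.
have Q2 : `|(p - q) ^+ 2| <= 2^-1.
  by apply: sqr4; rewrite -halfD (le_trans (ler_normB _ _)) // lerD.
rewrite (double_series_antidiagonals Ksum (C := 1)); last first.
  by apply: (quarter_bounded_monomials biexp_bounded_even_binomial); rewrite -natrM.
transitivity (csum (fun n =>
    2^-1 * (((p + q) ^+ 2) ^+ n - -1 * ((p - q) ^+ 2) ^+ n))).
  apply: eq_csum => n; rewrite mulN1r opprK mulrC -sum_even_binomial pX qY.
  by apply: eq_big_nat => j /andP[_]; rewrite ltnS => jn; rewrite /monomials subnKC.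
have Qc : half_bounded 1 (fun n => -1 * ((p - q) ^+ 2) ^+ n).
  by move=> n; rewrite mulN1r normrN half_bounded_geometric.
have PQc : half_bounded (1 + 1)
    (fun n => ((p + q) ^+ 2) ^+ n - -1 * ((p - q) ^+ 2) ^+ n).
  move=> n; apply: le_trans (ler_normB _ _) _.
  by rewrite mulrDl lerD ?half_bounded_geometric.
rewrite (csumZ Ksum _ PQc) (csumB Ksum (half_bounded_geometric P2) Qc).
rewrite (csumZ Ksum _ (half_bounded_geometric Q2)).
rewrite !(csum_geometric Ksum) //.
have := subr1_neq0_half P2; have := subr1_neq0_half Q2; rewrite -pX -qY => q0 p0.
have -> : 1 - 2 * (p ^+ 2 + q ^+ 2) + (p ^+ 2 - q ^+ 2) ^+ 2 =
  (1 - (p + q) ^+ 2) * (1 - (p - q) ^+ 2) by ring.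
by field; rewrite q0 p0.
Qed.

Lemma has_expansion_even_binomial :
  (forall z : K, exists w, w ^+ 2 = z) -> has_expansion
  (fun t x y : K => (1 - t * (x + y))
     / (1 - 2 * t * (x + y) + t ^+ 2 * (x - y) ^+ 2))
  (fun j k => 'C((j + k).*2, j.*2)%:R).
Proof.
move=> sqrt; exists 1, 4; split.
  exact: biexp_bounded_even_binomial.
move=> t x y; rewrite -natrM => X32 Y32.
rewrite even_binomial_expansion //.
- by congr (_ / _); ring.
- by rewrite ltW // -[16]mulr1 (@scaled_lt1_widen _ 1 16 32) // mulr1.
- by rewrite ltW // -[16]mulr1 (@scaled_lt1_widen _ 1 16 32) // mulr1.
Qed.

End EvenBinomialExpansion.

(** * Expansions over the complex numbers *)

Section ComplexExpansions.
Variable R : realType.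
Local Notation K := (R[i] : numFieldType).
Implicit Types (a b c : R[i]) (F : R[i] -> R[i] -> R[i] -> R[i]).

Let Ksum := @complex_sums_half_bounded R.

Lemma complex_ratio_bounded a c : (forall n : nat, c != - n%:R) ->
  exists L : K, ratio_bounded L a c.
Proof. exact: (@ratio_bounded_exists K _ _ (@complex_archi R)). Qed.

Lemma one_neq_oppn (n : nat) : 1 != - n%:R :> R[i].
Proof. by rewrite -addr_eq0 -[1]/(1%:R) -natrD pnatr_eq0. Qed.

Lemma has_expansion_power_product b1 b2 : @has_expansion K
  (fun t x y => cpow (1 - t * x) (- b1) * cpow (1 - t * y) (- b2))
  (fun j k => pochhammer_ratio b1 1 j * pochhammer_ratio b2 1 k).
Proof.
have [L1 b1L] := complex_ratio_bounded b1 one_neq_oppn.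
have [L2 b2L] := complex_ratio_bounded b2 one_neq_oppn.
have L10 : 0 <= L1 by apply: le_trans b1L.1.
have L20 : 0 <= L2 by apply: le_trans b2L.1.
have bL b L L' : ratio_bounded L b 1 -> L <= L' -> ratio_bounded L' b (1 : K).
  move=> [L1' bL] LL; split=> [|n]; first exact: le_trans LL.
  apply: le_trans (bL n) _; rewrite lerXn2r ?nnegrE // (le_trans ler01) //.
  exact: le_trans LL.
have b1L' : ratio_bounded (L1 + L2) b1 1 by apply: bL b1L _; rewrite lerDl.
have b2L' : ratio_bounded (L1 + L2) b2 1 by apply: bL b2L _; rewrite lerDr.
exists 1, (L1 + L2); split.
  split=> [|j k]; first by rewrite addr_ge0.
  by rewrite normrM mul1r exprD ler_pM ?b1L'.2 ?b2L'.2.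
move=> t x y Lx Ly.
rewrite -(binomial_seriesE b1L' Lx) -(binomial_seriesE b2L' Ly).
rewrite /binomial_series -(double_seriesM Ksum (C := 1)).
- by apply: eq_double_series => j k; rewrite /monomials; ring.
- apply: half_bounded_power (exp_bounded_ratio b1L') _.
  by apply/ltW/(@scaled_lt1_widen _ _ 2 8) => //; rewrite addr_ge0.
- apply: half_bounded_power (exp_bounded_ratio b2L') _.
  by apply/ltW/(@scaled_lt1_widen _ _ 2 8) => //; rewrite addr_ge0.
Qed.

(** The constant t = 1 gives the function of x and y alone. *)
Lemma has_expansion_power_sum a : @has_expansion K
  (fun t x y => cpow (1 - t * x - t * y) (- a))
  (binomial_coefs (pochhammer_ratio a 1)).
Proof.
have [L aL] := complex_ratio_bounded a one_neq_oppn.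
have uL := exp_bounded_ratio aL; have L0 := uL.1.
exists 1, (2 * L); split; first exact: biexp_bounded_binomial_coefs.
move=> t x y; rewrite mulrA -natrM => Lx Ly.
rewrite -(power_series_add Ksum uL); last 2 first.
- by apply/ltW/(@scaled_lt1_widen _ _ 8 16).
- by apply/ltW/(@scaled_lt1_widen _ _ 8 16).
rewrite -addrA -opprD -(binomial_seriesE aL) //.
have Lx2 : 8 * L * `|t * x| < 2^-1.
  rewrite -[ltRHS]mul1r ltr_pdivlMr ?ltr0n //; apply: le_lt_trans Lx.
  by rewrite le_eqVlt; apply/orP; left; apply/eqP; ring.
have Ly2 : 8 * L * `|t * y| < 2^-1.
  rewrite -[ltRHS]mul1r ltr_pdivlMr ?ltr0n //; apply: le_lt_trans Ly.
  by rewrite le_eqVlt; apply/orP; left; apply/eqP; ring.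
rewrite [ltRHS](_ : 1 = 2^-1 + 2^-1); last by field.
apply: le_lt_trans (ltrD Lx2 Ly2).
by rewrite -[leRHS]mulrDr ler_wpM2l ?mulr_ge0 // ler_normD.
Qed.

Lemma has_expansion_radius F v : @has_expansion K F v ->
  exists2 r : R, 0 < r & forall t x y,
    `|t * x| < r%:C -> `|t * y| < r%:C ->
    F t x y = double_series (@monomials K v (t * x) (t * y)).
Proof.
move=> [C [M [vM Fv]]]; have [m m0 ME] := ge0_complexE vM.1.
have r0 : 0 < (8 * m + 1)^-1 by rewrite invr_gt0 ltr_wpDl ?mulr_ge0 ?ltr01.
exists (8 * m + 1)^-1 => // t x y.
have small (z : K) : `|z| < (8 * m + 1)^-1%:C -> 8 * M * `|z| < 1.
  have [n n0 ->] := ge0_complexE (normr_ge0 z).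
  rewrite ltcR => nm; rewrite ME.
  have -> : 8 * m%:C * n%:C = (8 * m * n)%:C :> K.
    by rewrite !rmorphM /= rmorph_nat.
  change ((8 * m * n)%:C < 1%:C :> K); rewrite ltcR.
  apply: (@le_lt_trans _ _ ((8 * m + 1) * n)).
    by rewrite ler_wpM2r // lerDl.
  by rewrite mulrC -ltr_pdivlMr ?mul1r // ltr_wpDl ?mulr_ge0 ?ltr01.
by move=> /small tx /small ty; exact: Fv.
Qed.

End ComplexExpansions.

(** * Coefficients of the Appell series and the four identities *)

Section CoefficientIdentities.
Variable K : numFieldType.
Implicit Types (a b c d : K) (j k : nat).

Lemma pochhammer_half_double n :
  pochhammer (1 / 2) n * n`!%:R * 4 ^+ n = (n.*2)`!%:R :> K.
Proof.
elim: n => [|n IHn]; first by rewrite pochhammer0 !mul1r.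
rewrite pochhammerS doubleS !factS !natrM -IHn exprS.
rewrite -!natr1 -mul2n natrM; by field.
Qed.

Lemma half_pochhammer_neq0 n : pochhammer (1 / 2) n != 0 :> K.
Proof. exact/pochhammer_neq0/half_neq_oppn. Qed.

Lemma fact_neq0 n : n`!%:R != 0 :> K.
Proof. by rewrite pnatr_eq0 -lt0n fact_gt0. Qed.

Lemma even_binomialE j k :
  'C((j + k).*2, j.*2)%:R = pochhammer (1 / 2) (j + k) * (j + k)`!%:R /
    (pochhammer (1 / 2) j * j`!%:R * (pochhammer (1 / 2) k * k`!%:R)) :> K.
Proof.
have n0 : pochhammer (1 / 2) j * j`!%:R * (pochhammer (1 / 2) k * k`!%:R) != 0 :> K.
  by rewrite !mulf_neq0 ?half_pochhammer_neq0 ?fact_neq0.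
apply: (mulIf n0); rewrite divfK //.
have p4 : 4 ^+ (j + k) != 0 :> K by rewrite expf_neq0 // pnatr_eq0.
apply: (mulIf p4); rewrite pochhammer_half_double exprD.
have le : (j.*2 <= (j + k).*2)%N by rewrite leq_double leq_addr.
rewrite -(bin_fact le) -doubleB addKn !natrM -!pochhammer_half_double.
by ring.
Qed.

Lemma appellF3_coefE a1 b1 a2 b2 c j k : (forall n : nat, c != - n%:R) ->
  pochhammer_ratio a1 1 j * (pochhammer_ratio b1 (1 / 2) j *
  (pochhammer_ratio a2 1 k * (pochhammer_ratio b2 (1 / 2) k *
  (pochhammer_ratio (3 / 2) c (j + k) * arctan_expansion_coef K j k)))) =
  pochhammer a1 j * pochhammer b1 j * pochhammer a2 k * pochhammer b2 k
  / (pochhammer c (j + k) * j`!%:R * k`!%:R).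
Proof.
move=> hc; rewrite /pochhammer_ratio /arctan_expansion_coef !pochhammer1.
have := pochhammer_neq0 (j + k) (@three_halves_neq_oppn K).
have := pochhammer_neq0 (j + k) hc; have := half_pochhammer_neq0 j.
have := half_pochhammer_neq0 k; have := fact_neq0 j; have := fact_neq0 k.
move: (pochhammer (1 / 2) j) (pochhammer (1 / 2) k) (pochhammer (3 / 2) _).
move: (_`!%:R) (_`!%:R) (pochhammer c _) => p q r s t u *.
by field; do !(apply/andP; split).
Qed.

Lemma appellF4_coefE a b c d j k : (forall n : nat, c != - n%:R) ->
  (forall n : nat, d != - n%:R) ->
  pochhammer_ratio (1 / 2) c j * (pochhammer_ratio (1 / 2) d k *
  (pochhammer_ratio b (1 / 2) (j + k) * (pochhammer_ratio a 1 (j + k) *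
  'C((j + k).*2, j.*2)%:R))) =
  pochhammer a (j + k) * pochhammer b (j + k)
  / (pochhammer c j * pochhammer d k * j`!%:R * k`!%:R).
Proof.
move=> hc hd; rewrite even_binomialE /pochhammer_ratio !pochhammer1.
have := pochhammer_neq0 j hc; have := pochhammer_neq0 k hd.
have := half_pochhammer_neq0 j; have := half_pochhammer_neq0 k.
have := half_pochhammer_neq0 (j + k).
have := fact_neq0 j; have := fact_neq0 k; have := fact_neq0 (j + k).
move: (pochhammer (1 / 2) (j + k)) (pochhammer (1 / 2) j) (pochhammer (1 / 2) k).
move: ((j + k)`!%:R) (j`!%:R) (k`!%:R) (pochhammer c _) (pochhammer d _).
move=> p q r s t u v w *.
by field; do !(apply/andP; split).
Qed.

Lemma binomial_coefs_factE u j k :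
  binomial_coefs u j k = u (j + k)%N * ((j + k)`!%:R / (j`!%:R * k`!%:R)) :> K.
Proof.
rewrite /binomial_coefs -(bin_fact (leq_addr k j)) addKn !natrM.
by congr (_ * _); rewrite mulfK // mulf_neq0 ?fact_neq0.
Qed.

Lemma appellF2_coefE a b1 b2 c1 c2 j k :
  pochhammer_ratio b1 c1 j * (pochhammer_ratio b2 c2 k *
  binomial_coefs (pochhammer_ratio a 1) j k) =
  pochhammer a (j + k) / (j`!%:R * k`!%:R)
  * (pochhammer b1 j * pochhammer b2 k / (pochhammer c1 j * pochhammer c2 k)).
Proof.
rewrite binomial_coefs_factE /pochhammer_ratio pochhammer1 -mulf_div.
rewrite mulrA mulrC; congr (_ * _).
by rewrite mulrA divfK ?fact_neq0.
Qed.

End CoefficientIdentities.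

Unset Implicit Arguments.

Theorem proposition3 (R : realType) (a b b1 b2 a1 a2 c c1 c2 d : R[i])
  (hc : forall n : nat, c != - n%:R)
  (hc1 : forall n : nat, c1 != - n%:R)
  (hc2 : forall n : nat, c2 != - n%:R)
  (hd : forall n : nat, d != - n%:R) :
  exists2 r : R, 0 < r &
    forall t x y : R[i], `|t| < r%:C -> `|x| < r%:C -> `|y| < r%:C ->
    [/\ hyp_t a c
          (fun t x y => cpow (1 - t * x) (- b1) * cpow (1 - t * y) (- b2))
          t x y
        = appellF1 a b1 b2 c (t * x) (t * y),
        (hyp_x b1 c1 \o hyp_y b2 c2)
          (fun _ x y => cpow (1 - x - y) (- a))
          t x y
        = appellF2 a b1 b2 c1 c2 x y,
        (hyp_x a1 1 \o hyp_x b1 (1 / 2) \o hyp_y a2 1 \o hyp_y b2 (1 / 2)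
         \o hyp_t (3 / 2) c)
          (fun t x y =>
             arctan_sqrt_div_sqrt (t ^+ 2 * x * y - t * x - t * y))
          t x y
        = appellF3 a1 b1 a2 b2 c (t * x) (t * y)
      & (hyp_x (1 / 2) c \o hyp_y (1 / 2) d \o hyp_t b (1 / 2) \o hyp_t a 1)
          (fun t x y => (1 - t * (x + y))
             / (1 - 2 * t * (x + y) + t ^+ 2 * (x - y) ^+ 2))
          t x y
        = appellF4 a b c d (t * x) (t * y)].
Proof.
have Ksum := @complex_sums_half_bounded R.
have one0 := @one_neq_oppn R; have half0 := @half_neq_oppn (R[i] : numFieldType).
have [Lac HLac] := complex_ratio_bounded a hc.
have [Lb1 HLb1] := complex_ratio_bounded b1 hc1.
have [Lb2 HLb2] := complex_ratio_bounded b2 hc2.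
have [La11 HLa11] := complex_ratio_bounded a1 one0.
have [Lb1h HLb1h] := complex_ratio_bounded b1 half0.
have [La21 HLa21] := complex_ratio_bounded a2 one0.
have [Lb2h HLb2h] := complex_ratio_bounded b2 half0.
have [L3c HL3c] := complex_ratio_bounded (3 / 2) hc.
have [Lhc HLhc] := complex_ratio_bounded (1 / 2) hc.
have [Lhd HLhd] := complex_ratio_bounded (1 / 2) hd.
have [Lbh HLbh] := complex_ratio_bounded b half0.
have [La1 HLa1] := complex_ratio_bounded a one0.
have /has_expansion_radius[r1 r10 H1] :=
  has_expansion_hyp_t Ksum HLac (has_expansion_power_product b1 b2).
have /has_expansion_radius[r2 r20 H2] :=
  has_expansion_hyp_x Ksum HLb1
  (has_expansion_hyp_y Ksum HLb2 (has_expansion_power_sum a)).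
have /has_expansion_radius[r3 r30 H3] :=
  has_expansion_hyp_x Ksum HLa11 (has_expansion_hyp_x Ksum HLb1h
  (has_expansion_hyp_y Ksum HLa21 (has_expansion_hyp_y Ksum HLb2h
  (has_expansion_hyp_t Ksum HL3c (has_expansion_arctan Ksum))))).
have sqrt (z : R[i]) : exists w, w ^+ 2 = z by exists (sqrtc z); exact: sqr_sqrtc.
have /has_expansion_radius[r4 r40 H4] :=
  has_expansion_hyp_x Ksum HLhc (has_expansion_hyp_y Ksum HLhd
  (has_expansion_hyp_t Ksum HLbh (has_expansion_hyp_t Ksum HLa1
  (has_expansion_even_binomial Ksum sqrt)))).
(* r <= 1 makes |t x| and |t y| at most |x| and |y| *)
pose r := Num.min 1 (Num.min (Num.min r1 r2) (Num.min r3 r4)).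
have r0 : 0 < r by rewrite !lt_min ltr01 r10 r20 r30 r40.
exists r => // t x y tr xr yr.
have [rr1 rr2 rr3 rr4 rr5] : [/\ r <= 1, r <= r1, r <= r2, r <= r3 & r <= r4].
  by split; rewrite !ge_min lexx ?orbT.
have prod (z : R[i]) (s : R) : `|z| < r%:C -> r <= s -> `|t * z| < s%:C.
  move=> zr rs; apply: lt_le_trans (_ : r%:C <= _); last by rewrite lecR.
  apply: le_lt_trans zr; rewrite normrM ler_piMl //.
  by apply: le_trans (ltW tr) _; rewrite -[1]/(1%:C) lecR.
split.
- rewrite H1 ?prod //; apply: eq_double_series => j k; rewrite /monomials.
  by congr (_ * _ * _); rewrite /pochhammer_ratio !pochhammer1 -mulf_div.
(* t does not occur, and the expansion is read at t = 1 *)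
- have -> : (hyp_x b1 c1 \o hyp_y b2 c2) (fun _ x y => cpow (1 - x - y) (- a)) t x y
    = hyp_x b1 c1 (hyp_y b2 c2 (fun t x y => cpow (1 - t * x - t * y) (- a))) 1 x y.
    rewrite /= /hyp_x /hyp_y; congr (hypergeometrization _ _ _ x).
    apply/funext => s; congr (hypergeometrization _ _ _ y).
    by apply/funext => s'; rewrite !mul1r.
  have xr2 : `|1 * x| < r2%:C by rewrite mul1r (lt_le_trans xr) // lecR.
  have yr2 : `|1 * y| < r2%:C by rewrite mul1r (lt_le_trans yr) // lecR.
  rewrite H2 // !mul1r; apply: eq_double_series => j k; rewrite /monomials.
  by congr (_ * _ * _); exact: appellF2_coefE.
- rewrite [LHS]H3 ?prod //; apply: eq_double_series => j k; rewrite /monomials.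
  by congr (_ * _ * _); exact: appellF3_coefE.
- rewrite [LHS]H4 ?prod //; apply: eq_double_series => j k; rewrite /monomials.
  by congr (_ * _ * _); exact: appellF4_coefE.
Qed.
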